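(* Let $\alpha\in[0,1]$. For any $f\in L^2(K,\mu)$ and $t>0$ we have $$\lim_{\varepsilon\to0}(P^{\varepsilon}_{\alpha}(t)\widetilde f)_{|K}=T^{K}_{\alpha}(t)f\quad\text{in }L^2(K,\mu)$$ and, for $\lambda>0$, $$\lim_{\varepsilon\to0}(R(\lambda,M^{\varepsilon}_{\alpha})\widetilde f)_{|K}=(\lambda-L^{K}_{\alpha})^{-1}f\quad\text{in }L^2(K,\mu).$$
   Context: $H$ is an infinite-dimensional separable real Hilbert space; $Q$ is a bounded symmetric strictly positive operator on $H$ with finite trace, $A:=Q^{-1}$, and $\mu=\mathcal N_Q$ is the centered Gaussian measure on $H$ with covariance $Q$. $K\subset H$ is a closed set with nonempty interior (so $\mu(K)>0$) and $\mu(K^c)>0$. For a function $f$ on $K$, $\widetilde f$ denotes its extension by $0$ to $H$. $R(\lambda,B)=(\lambda-B)^{-1}$ denotes the resolvent. $X_\alpha(t,x)$ is the (mild) solution, with a.s. continuous paths, of $dX_\alpha(t,x)=-\frac12A^\alpha X_\alpha(t,x)\,dt+A^{(\alpha-1)/2}dW(t)$, $X_\alpha(0,x)=x$, where $W$ is a standard cylindrical Wiener process in $H$ on a filtered probability space $(\Omega,\mathcal F,(\mathcal F_t)_{t\ge0},\mathbb P)$. $V:H\to\mathbb R$ is a fixed bounded continuous function with $V=0$ on $K$ and $V>0$ on $K^c$. For $\varepsilon>0$, $P^{\varepsilon}_\alpha(t)\varphi(x)=\mathbb E\big[\varphi(X_\alpha(t,x))e^{-\frac1\varepsilon\int_0^tV(X_\alpha(s,x))ds}\big]$;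 it extends uniquely from $C_b(H)$ to a $C_0$-semigroup of contractions in $L^2(H,\mu)$ (same symbol), whose infinitesimal generator is $M^\varepsilon_\alpha$. For $x\in K$ let $\tau_x:=\inf\{t\ge0:\,X_\alpha(t,x)\in K^c\}$ (with $\inf\emptyset=+\infty$). For bounded Borel $\varphi:K\to\mathbb R$, $T^K_\alpha(t)\varphi(x)=\mathbb E[\varphi(X_\alpha(t,x))\mathbf 1_{\{\tau_x\ge t\}}]$, $x\in K$; it extends uniquely to a contraction semigroup in $L^2(K,\mu)$ (same symbol), and $L^K_\alpha$ is its infinitesimal generator, with resolvent $R(\lambda,L^K_\alpha)f=(\lambda-L^K_\alpha)^{-1}f=\int_0^\infty e^{-\lambda t}T^K_\alpha(t)f\,dt$ for $\lambda>0$, $f\in L^2(K,\mu)$. *)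

(* Defs.v *)
From HB Require Import structures.
From mathcomp Require Import all_boot all_order all_algebra.
From mathcomp Require Import sesquilinear.
From mathcomp Require Import all_classical all_reals all_analysis.
Import Order.TTheory GRing.Theory Num.Theory.
Import numFieldNormedType.Exports.

Set Implicit Arguments.
Unset Strict Implicit.
Unset Printing Implicit Defensive.

Local Open Scope classical_set_scope.
Local Open Scope ring_scope.

Notation borel H := (g_sigma_algebraType (@open H)).

Lemma closed_borel (H : ptopologicalType) (K : set H) :
  closed K -> measurable (K : set (borel H)).
Proof.
move=> cK; rewrite -(setCK (K : set (borel H))); apply: measurableC.
by apply: sub_sigma_algebra; exact: closed_openC.
Qed.

Section hilbert.
Context {R : realType} {H : completeNormedModType R}.
Variable ip : {dot H for idfun}.

(* [H], complete for its norm, is a Hilbert space with inner product [ip]. *)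
Definition norm_from_ip : Prop := forall x : H, `|x| ^+ 2 = ip x x.

Definition separable : Prop := exists D : set H, countable D /\ dense D.

Definition infinite_dimensional : Prop :=
  forall (n : nat) (b : 'I_n -> H),
    exists x, forall c : 'I_n -> R, x <> \sum_(i < n) c i *: b i.

Definition orthonormal_basis (e : nat -> H) : Prop :=
  (forall i j, ip (e i) (e j) = (i == j)%:R) /\
  (forall x, (forall i, ip x (e i) = 0) -> x = 0).

Definition finite_trace (Q : H -> H) : Prop :=
  exists2 e, orthonormal_basis e &
    (\sum_(0 <= k <oo) (ip (Q (e k)) (e k))%:E < +oo)%E.

Definition covariance_operator (Q : {linear H -> H}) : Prop :=
  [/\ continuous Q,
      forall x y, ip (Q x) y = ip x (Q y),
      forall x, x != 0 -> 0 < ip (Q x) x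
    & finite_trace Q].

(* The centered Gaussian measure N_Q: every nonzero continuous linear functional
   <., h> is normal with mean 0 and variance <Q h, h>.  ([normal_prob] takes the
   standard deviation; for h = 0 the functional is identically 0.) *)
Definition gaussian_measure (Q : H -> H) (mu : probability (borel H) R) : Prop :=
  forall h, h != 0 -> forall B : set R, measurable B ->
    mu [set x | B (ip x h)] = normal_prob 0 (Num.sqrt (ip (Q h) h)) B.

(* [op_fun Q g] is the bounded operator g(A) for A = Q^-1, with g bounded on the
   spectrum of A: it acts as g(a) on the eigenvectors A x = a x, written here as
   Q (a x) = x.  As Q is compact, symmetric and injective, its eigenvectors span
   a dense subspace, so that this determines the operator. *)
Definition op_fun (Q : H -> H) (g : R -> R) : H -> H :=
  xget (fun=> 0) [set B : H -> H | [/\ linear B, continuous B &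
    forall a x, Q (a *: x) = x -> B x = g a *: x]].

(* e^{-t A^alpha / 2} *)
Definition ou_semigroup (Q : H -> H) (alpha t : R) : H -> H :=
  op_fun Q (fun a => expR (- (t / 2) * a `^ alpha)).

(* A^{(alpha - 1) / 2} *)
Definition ou_noise (Q : H -> H) (alpha : R) : H -> H :=
  op_fun Q (fun a => a `^ ((alpha - 1) / 2)).

Section process.
Context {d : measure_display} {Omega : measurableType d}.
Variable Pr : probability Omega R.

Definition filtration (F : R -> set (set Omega)) : Prop :=
  [/\ forall t, 0 <= t -> sigma_algebra setT (F t),
      forall t, 0 <= t -> F t `<=` measurable
    & forall s t, 0 <= s -> s <= t -> F s `<=` F t].

(* Standard cylindrical Wiener process in H relative to [F]; [W t h] stands for
   the real random variable <W(t), h>. *)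
Record cylindrical_wiener (F : R -> set (set Omega)) (W : R -> H -> Omega -> R)
    : Prop := {
  wiener_adapted : forall (t : R) (h : H) (B : set R), 0 <= t -> measurable B ->
    F t (W t h @^-1` B);
  wiener_start : forall h, {ae Pr, forall w, W 0 h w = 0};
  wiener_linear : forall (t a : R) (h k : H), 0 <= t ->
    {ae Pr, forall w, W t (a *: h + k) w = a * W t h w + W t k w};
  wiener_increment : forall (s t : R) (h : H) (B : set R),
    0 <= s -> s < t -> h != 0 -> measurable B ->
    Pr [set w | B (W t h w - W s h w)] =
      normal_prob 0 (Num.sqrt (t - s) * `|h|) B;
  wiener_independent : forall (s t : R) (h : H) (A : set Omega) (B : set R),
    0 <= s -> s < t -> F s A -> measurable B ->
    Pr (A `&` [set w | B (W t h w - W s h w)%R]) =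
      (Pr A * Pr [set w | B (W t h w - W s h w)%R])%E;
  wiener_continuous : forall h,
    {ae Pr, forall w, {within `[0, +oo[, continuous (fun t => W t h w)}}
}.

(* [I] is the stochastic integral over [0, t] of the deterministic integrand
   s |-> <g(s), dW(s)>, with g continuous: by the Ito isometry it is the limit in
   L^2(Omega) of the left-endpoint Riemann sums. *)
Definition is_wiener_integral (W : R -> H -> Omega -> R) (t : R) (g : R -> H)
    (I : Omega -> R) : Prop :=
  (fun n : nat =>
    \int[Pr]_w (((I w - \sum_(i < n.+1)
      (W (t * i.+1%:R / n.+1%:R) (g (t * i%:R / n.+1%:R)) w
       - W (t * i%:R / n.+1%:R) (g (t * i%:R / n.+1%:R)) w)) ^+ 2)%R)%:E)%E
  @ \oo --> 0%E.

(* Mild solution, with a.s. continuous paths, of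
     dX = - A^alpha X / 2 dt + A^{(alpha-1)/2} dW,   X(0) = x,
   that is X(t) = S(t) x + \int_0^t S(t - s) A^{(alpha-1)/2} dW(s) a.s. where
   S(t) = e^{-t A^alpha / 2}.  The identity is tested against every h in H, the
   adjoint of S(t - s) A^{(alpha-1)/2} being A^{(alpha-1)/2} S(t - s). *)
Record mild_solution (F : R -> set (set Omega)) (W : R -> H -> Omega -> R)
    (Q : H -> H) (alpha : R) (x : H) (X : R -> Omega -> H) : Prop := {
  mild_adapted : forall (t : R) (B : set (borel H)), 0 <= t -> measurable B ->
    F t (X t @^-1` B);
  mild_continuous :
    {ae Pr, forall w, {within `[0, +oo[, continuous (fun t => X t w)}};
  mild_formula : forall (t : R) (h : H), 0 <= t ->
    is_wiener_integral W t
      (fun s => ou_noise Q alpha (ou_semigroup Q alpha (t - s) h))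
      (fun w => ip (X t w - ou_semigroup Q alpha t x) h)
}.

(* E[phi(X(t,x)) exp(- eps^-1 \int_0^t V(X(s,x)) ds)] *)
Definition feynman_kac (X : R -> H -> Omega -> H) (V : H -> R) (eps t : R)
    (phi : H -> R) (x : H) : R :=
  \int[Pr]_w (phi (X t x w) *
    expR (- (eps^-1 * \int[lebesgue_measure]_(s in `[0, t]) V (X s x w)))).

Definition exit_time (X : R -> H -> Omega -> H) (K : set H) (x : H) (w : Omega)
    : \bar R :=
  ereal_inf [set s%:E | s in [set s : R | 0 <= s /\ (~` K) (X s x w)]].

(* E[phi(X(t,x)) 1_{tau_x >= t}] *)
Definition killed_expectation (X : R -> H -> Omega -> H) (K : set H) (t : R)
    (phi : H -> R) (x : H) : R :=
  \int[Pr]_w (phi (X t x w) *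
    \1_[set w | (t%:E <= exit_time X K x w)%E] w).

End process.
End hilbert.

(* L^2(m) is handled through representatives: its elements are the functions in
   [Lfun m 2], equality is equality m-a.e., and operators act on representatives.
   An a.e. linear contraction preserves a.e. equality. *)
Section L2.
Context {R : realType} {d : measure_display} {E : measurableType d}.
Variable m : {measure set E -> \bar R}.

Definition L2 (f : E -> R) : Prop := f \in Lfun m 2%:E.

Definition L2norm (f : E -> R) : \bar R := ('N[m]_2%:E[EFin \o f])%E.

(* u_eps converges to w in L^2(m) as eps -> 0, eps > 0 *)
Definition L2_lim0 (u : R -> E -> R) (w : E -> R) : Prop :=
  L2norm (u eps \- w) @[eps --> 0^'+] --> 0%E.

Record contraction_semigroup (T : R -> (E -> R) -> E -> R) : Prop := {
  semigroup_L2 : forall t f, 0 <= t -> L2 f -> L2 (T t f);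
  semigroup_linear : forall t a f g, 0 <= t -> L2 f -> L2 g ->
    {ae m, forall x, T t (a \*: f \+ g) x = a * T t f x + T t g x};
  semigroup_contraction : forall t f, 0 <= t -> L2 f ->
    (L2norm (T t f) <= L2norm f)%E;
  semigroup_0 : forall f, L2 f -> {ae m, forall x, T 0 f x = f x};
  semigroup_D : forall s t f, 0 <= s -> 0 <= t -> L2 f ->
    {ae m, forall x, T (s + t) f x = T s (T t f) x}
}.

Definition strongly_continuous (T : R -> (E -> R) -> E -> R) : Prop :=
  forall f, L2 f -> L2_lim0 (T^~ f) f.

(* [u] is in the domain of the infinitesimal generator of [T], with image [v]. *)
Definition generator (T : R -> (E -> R) -> E -> R) (u v : E -> R) : Prop :=
  [/\ L2 u, L2 v & L2_lim0 (fun h x => h^-1 * (T h u x - u x)) v].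

(* [Res] is a left inverse of lam - L, L the generator of [T]. *)
Definition resolvent_left_inverse (T : R -> (E -> R) -> E -> R) (lam : R)
    (Res : (E -> R) -> E -> R) : Prop :=
  forall u v, generator T u v ->
    {ae m, forall x, Res (fun y => lam * u y - v y) x = u x}.

(* (lam - L) (Res f) = f, i.e. L (Res f) = lam Res f - f *)
Definition resolvent_right_inverse (T : R -> (E -> R) -> E -> R) (lam : R)
    (Res : (E -> R) -> E -> R) : Prop :=
  forall f, L2 f -> generator T (Res f) (fun x => lam * Res f x - f x).

Definition is_resolvent (T : R -> (E -> R) -> E -> R) (lam : R)
    (Res : (E -> R) -> E -> R) : Prop :=
  resolvent_left_inverse T lam Res /\ resolvent_right_inverse T lam Res.

(* Res f = \int_0^oo e^{-lam t} T(t) f dt, as an integral in L^2(m) tested against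
   the elements of L^2(m). *)
Definition laplace_transform (T : R -> (E -> R) -> E -> R) (lam : R)
    (Res : (E -> R) -> E -> R) : Prop :=
  forall f, L2 f -> L2 (Res f) /\ forall g, L2 g ->
    let F t := expR (- (lam * t)) * \int[m]_x (T t f x * g x) in
    lebesgue_measure.-integrable `[0, +oo[ (EFin \o F) /\
    \int[lebesgue_measure]_(t in `[0, +oo[) F t = \int[m]_x (Res f x * g x).

(* For a contraction semigroup that need not be strongly continuous at 0 (such
   as the killed semigroup when the process leaves K at once from a non
   negligible set of starting points), lam - L need not be onto and its inverse
   is understood as the Laplace transform, defined on the whole of L^2(m). *)
Definition is_laplace_resolvent (T : R -> (E -> R) -> E -> R) (lam : R)
    (Res : (E -> R) -> E -> R) : Prop :=
  resolvent_left_inverse T lam Res /\ laplace_transform T lam Res.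

End L2.

Section penalized_and_killed.
Context {R : realType} {H : completeNormedModType R}.
Context {d : measure_display} {Omega : measurableType d}.
Variables (Pr : probability Omega R) (X : R -> H -> Omega -> H).

Record penalized_semigroup (mu : probability (borel H) R) (V : H -> R) (eps : R)
    (P : R -> (borel H -> R) -> borel H -> R) : Prop := {
  penalized_contraction : contraction_semigroup mu P;
  penalized_continuous : strongly_continuous mu P;
  penalized_extends : forall t (phi : H -> R), 0 <= t ->
    continuous phi -> bounded_fun phi ->
    {ae mu, forall x, P t phi x = feynman_kac Pr X V eps t phi x}
}.

(* L^2(K, mu) is L^2 for the restricted measure; functions on K are represented
   by functions on H, whose values off K are irrelevant. *)
Definition muK (mu : probability (borel H) R) (K : set H) (cK : closed K)
    : {measure set (borel H) -> \bar R} := mrestr mu (closed_borel cK).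

Record killed_semigroup (mu : probability (borel H) R) (K : set H)
    (cK : closed K) (T : R -> (borel H -> R) -> borel H -> R) : Prop := {
  killed_contraction : contraction_semigroup (muK mu cK) T;
  killed_extends : forall t (phi : borel H -> R), 0 <= t ->
    measurable_fun setT phi -> bounded_fun phi ->
    {ae muK mu cK, forall x, T t phi x = killed_expectation Pr X K t phi x}
}.

Definition zero_ext (K : set H) (f : H -> R) : H -> R :=
  fun x => if x \in K then f x else 0.

End penalized_and_killed.

(* Main.v *)
Require Import Defs.
From HB Require Import structures.
From mathcomp Require Import all_boot all_order all_algebra.
From mathcomp Require Import sesquilinear.
From mathcomp Require Import all_classical all_reals all_analysis.
From mathcomp Require Import measurable_realfun.
From mathcomp Require Import ring lra.
Import Order.TTheory GRing.Theory Num.Theory.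
Import numFieldNormedType.Exports.
Local Open Scope classical_set_scope.
Local Open Scope ring_scope.

Set Implicit Arguments.
Unset Strict Implicit.
Unset Printing Implicit Defensive.

(* Along a continuous path, the integral over [0, t] of V(X_s) vanishes exactly
   when the path stays in K up to time t, that is when tau_x >= t.  Dominated
   convergence in Omega therefore gives P^eps(t) phi -> T(t) phi pointwise on K
   for phi bounded and continuous, hence in L^2(K, mu); density of C_b(H) in
   L^2(H, mu) and contractivity extend this to the extension by zero of any f in
   L^2(K, mu).  For the resolvents, both sides are Laplace transforms, so that
   testing u = R(lam, M^eps) f~ - R(lam, L) f against u itself gives
     |u| <= \int_0^oo e^{-lam t} |P^eps(t) f~ - T(t) f| dt,
   the norms being those of L^2(K, mu), and the right-hand side tends to 0 by
   dominated convergence in t. *)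

(** * The norm and inner product of L^2 *)

(** Three obstacles shape the argument. Paths are continuous only almost surely, so the Feynman-Kac
    integrand and the event tau_x >= t are seen to be measurable only after a modification on a null
    set. The semigroups agree with the expectations only up to null sets, which may depend on eps;
    hence the limit eps -> 0 is taken along sequences, which also suits dominated convergence.
    Finally T need not be strongly continuous, so the measurability in t of |P^eps(t) f~ - T(t) f|
    has to be derived from the orbits of the penalized semigroups. The two resolvents come in
    different forms: that of M^eps as an inverse of lam - M^eps, that of L as a weak Laplace
    transform. The first is brought to the second form by integrating the derivative of -e^{-lam t}
    <P^eps(t) u, g> over the half-line. Working with a test function g keeps every integral
    scalar. *)

Section L2_theory.
Context {R : realType} {d : measure_display} {E : measurableType d}.
Variable m : {measure set E -> \bar R}.
Implicit Types f g h : E -> R.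

(** [fine] sends an infinite norm to 0, so the estimates on [L2nrm] assume or derive membership in
    L^2. *)
Definition L2nrm f : R := fine (L2norm m f).
Definition L2dot f g : R := \int[m]_x (f x * g x).

Lemma L2_measurable f : L2 m f -> measurable_fun setT f.
Proof. by rewrite /L2 inE => /andP[]; rewrite inE. Qed.

Lemma L2_lty f : L2 m f -> (L2norm m f < +oo)%E.
Proof. by rewrite /L2 inE => /andP[_]; rewrite inE. Qed.

Lemma L2_of_lty f : measurable_fun setT f -> (L2norm m f < +oo)%E -> L2 m f.
Proof. by move=> mf nf; rewrite /L2 inE; apply/andP; split; rewrite inE. Qed.

Lemma L2nrmE f : L2 m f -> L2norm m f = (L2nrm f)%:E.
Proof. by move=> /L2_lty lf; rewrite fineK// ge0_fin_numE// Lnorm_ge0. Qed.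

Lemma L2nrm_ge0 f : 0 <= L2nrm f.
Proof. by rewrite fine_ge0// Lnorm_ge0. Qed.

Lemma L2_lin (a : R) f g : L2 m f -> L2 m g -> L2 m (fun x => a * f x + g x).
Proof.
move=> lf lg; have p1 : (1 <= 2%:E :> \bar R)%E by rewrite lee1n.
exact: (Lfun_submod_closed m p1).2.
Qed.

Lemma L2Z (a : R) f : L2 m f -> L2 m (fun x => a * f x).
Proof.
move=> lf; have p1 : (1 <= 2%:E :> \bar R)%E by rewrite lee1n.
have := (Lfun_submod_closed m p1).2 a f _ lf (Lfun_submod_closed m p1).1.
by rewrite addr0.
Qed.

Lemma L2D f g : L2 m f -> L2 m g -> L2 m (fun x => f x + g x).
Proof.
move=> lf lg; have := L2_lin 1 lf lg.
by rewrite (_ : (fun _ => _) = (fun x => f x + g x))//; apply/funext => x; rewrite mul1r.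
Qed.

Lemma L2B f g : L2 m f -> L2 m g -> L2 m (fun x => f x - g x).
Proof.
move=> lf lg; have := L2_lin (-1) lg lf.
by rewrite (_ : (fun _ => _) = (fun x => f x - g x))//; apply/funext => x; ring.
Qed.

Lemma L2norm_ae_eq f g : measurable_fun setT f -> measurable_fun setT g ->
  {ae m, forall x, f x = g x} -> L2norm m f = L2norm m g.
Proof.
move=> mf mg fg; rewrite /L2norm unlock; congr poweR.
apply: ae_eq_integral => //=.
- apply/measurable_EFinP/(@measurableT_comp _ _ _ _ _ _ (@powR R ^~ 2)) => //.
  exact: measurableT_comp.
- apply/measurable_EFinP/(@measurableT_comp _ _ _ _ _ _ (@powR R ^~ 2)) => //.
  exact: measurableT_comp.
- by apply: filterS fg => x -> _.
Qed.

Lemma L2nrm_ae_eq f g : L2 m f -> L2 m g ->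
  {ae m, forall x, f x = g x} -> L2nrm f = L2nrm g.
Proof.
move=> lf lg fg; rewrite /L2nrm; congr fine.
by apply: L2norm_ae_eq => //; exact: L2_measurable.
Qed.

Lemma L2nrmD f g : L2 m f -> L2 m g -> L2nrm (fun x => f x + g x) <= L2nrm f + L2nrm g.
Proof.
move=> lf lg; rewrite -lee_fin EFinD -!L2nrmE//; last exact: L2D.
apply: (@minkowski_EFin _ _ _ m f g); rewrite ?ler1n//; exact: L2_measurable.
Qed.

Lemma L2nrmZ a f : L2 m f -> L2nrm (fun x => a * f x) = `|a| * L2nrm f.
Proof.
move=> lf; apply: EFin_inj; rewrite EFinM -!L2nrmE//; last exact: L2Z.
have p1 : (1 <= 2%:E :> \bar R)%E by rewrite lee1n.
have := @LnormZ _ _ _ m _ p1 (Lfun_Sub p1 lf) a.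
by [].
Qed.

Lemma L2nrm_triangle h f g : L2 m f -> L2 m g -> L2 m h ->
  L2nrm (fun x => f x - g x) <= L2nrm (fun x => f x - h x) + L2nrm (fun x => h x - g x).
Proof.
move=> lf lg lh; apply: le_trans (L2nrmD (L2B lf lh) (L2B lh lg)).
by rewrite le_eqVlt; apply/orP; left; apply/eqP; congr L2nrm; apply/funext => x; ring.
Qed.

Lemma L2nrmC f g : L2 m f -> L2 m g -> L2nrm (fun x => f x - g x) = L2nrm (fun x => g x - f x).
Proof.
move=> lf lg; have := L2nrmZ (-1) (L2B lg lf); rewrite normrN1 mul1r => <-.
by congr L2nrm; apply/funext => x; ring.
Qed.

Lemma L2nrm_dist h f g : L2 m f -> L2 m g -> L2 m h ->
  `|L2nrm (fun x => f x - h x) - L2nrm (fun x => g x - h x)| <= L2nrm (fun x => f x - g x).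
Proof.
move=> lf lg lh; have h1 := L2nrm_triangle lf lh lg; have h2 := L2nrm_triangle lg lh lf.
rewrite (L2nrmC lg lf) in h2; rewrite ler_norml; apply/andP; split; lra.
Qed.

Lemma L2nrm_sqr f : L2 m f -> ((L2nrm f ^+ 2)%:E = \int[m]_x (f x ^+ 2)%:E)%E.
Proof.
move=> lf; have n20 : (2 : R) != 0 by [].
have := poweR_Lnorm m (EFin \o f) n20.
rewrite -/(L2norm m f) L2nrmE// poweR_EFin powR_mulrn ?L2nrm_ge0// => ->.
by apply: eq_integral => x _; rewrite /= powR_mulrn// real_normK ?num_real.
Qed.

Lemma L2dot_integrable f g : L2 m f -> L2 m g ->
  m.-integrable setT (EFin \o (fun x => f x * g x)).
Proof. by move=> lf lg; apply/Lfun1_integrable; exact: Lfun2_mul_Lfun1. Qed.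

Lemma L2dotBl f g h : L2 m f -> L2 m g -> L2 m h ->
  L2dot (fun x => f x - g x) h = L2dot f h - L2dot g h.
Proof.
move=> lf lg lh; rewrite /L2dot -RintegralB//; [|exact: L2dot_integrable..].
by apply: eq_Rintegral => x _; rewrite mulrBl.
Qed.

Lemma L2dotZl a f h : L2 m f -> L2 m h -> L2dot (fun x => a * f x) h = a * L2dot f h.
Proof.
move=> lf lh; rewrite /L2dot -RintegralZl//; last exact: L2dot_integrable.
by apply: eq_Rintegral => x _; rewrite mulrA.
Qed.

Lemma L2dot_ae_eq f g h : L2 m f -> L2 m g -> L2 m h ->
  {ae m, forall x, f x = g x} -> L2dot f h = L2dot g h.
Proof.
move=> lf lg lh fg; rewrite /L2dot /Rintegral; congr fine.
apply: ae_eq_integral => //.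
- exact: measurable_int (L2dot_integrable lf lh).
- exact: measurable_int (L2dot_integrable lg lh).
- by apply: filterS fg => x -> _.
Qed.

Lemma L2dot_sqr f : L2 m f -> L2dot f f = L2nrm f ^+ 2.
Proof.
move=> lf; apply: EFin_inj; rewrite L2nrm_sqr// /L2dot /Rintegral fineK.
  by apply: eq_integral => x _; rewrite expr2.
by apply: integrable_fin_num => //; exact: L2dot_integrable.
Qed.

Lemma L2dot_le f g : L2 m f -> L2 m g -> `|L2dot f g| <= L2nrm f * L2nrm g.
Proof.
move=> lf lg; have ifg := L2dot_integrable lf lg.
apply: le_trans (le_normr_Rintegral measurableT ifg) _.
rewrite -lee_fin EFinM -!L2nrmE// fineK.
  have := @hoelder _ _ _ m f g 2 2 (L2_measurable lf) (L2_measurable lg).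
  rewrite Lnorm1; apply => //; lra.
rewrite integrable_fin_num//; exact: integrable_norm.
Qed.

Lemma L2dot_dist f g h : L2 m f -> L2 m g -> L2 m h ->
  `|L2dot f h - L2dot g h| <= L2nrm (fun x => f x - g x) * L2nrm h.
Proof. by move=> lf lg lh; rewrite -L2dotBl// L2dot_le//; exact: L2B. Qed.

Lemma L2_dominated f g : measurable_fun setT f -> L2 m g ->
  {ae m, forall x, `|f x| <= g x} -> L2 m f.
Proof.
move=> mf lg fg; apply: L2_of_lty => //; apply: le_lt_trans (L2_lty lg).
rewrite /L2norm unlock gt0_ler_poweR//.
- by rewrite in_itv/= leey integral_ge0// => x _; rewrite poweR_ge0.
- by rewrite in_itv/= leey integral_ge0// => x _; rewrite poweR_ge0.
have mp (h : E -> R) : measurable_fun setT h ->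
    measurable_fun setT (fun x => (`|h x| `^ 2)%:E).
  move=> mh.
  apply/measurable_EFinP/(@measurableT_comp _ _ _ _ _ _ (@powR R ^~ 2)) => //.
  exact: measurableT_comp.
apply: ae_ge0_le_integral => //=.
- exact: mp.
- by apply: mp; exact: L2_measurable.
- apply: filterS fg => x fx _; rewrite lee_fin ge0_ler_powR//.
  by rewrite (le_trans fx)// ler_norm.
Qed.

(** Dominated convergence for the squares, with majorant g^2, followed by continuity of the square
    root. It serves both for the density of C_b and for the limit of P^eps(t) phi. *)
Lemma L2nrm_dominated_cvg0 (u : nat -> E -> R) g :
  (forall n, measurable_fun setT (u n)) -> L2 m g ->
  {ae m, forall x n, `|u n x| <= g x} ->
  {ae m, forall x, u n x @[n --> \oo] --> 0} ->
  L2nrm (u n) @[n --> \oo] --> 0.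
Proof.
move=> mu_ lg ug u0.
have lu n : L2 m (u n).
  by apply: (L2_dominated (mu_ n) lg); apply: filterS ug => x /(_ n).
have sq0 : L2nrm (u n) ^+ 2 @[n --> \oo] --> 0.
  have [] := @dominated_convergence _ _ _ m setT measurableT
    (fun n x => (u n x ^+ 2)%:E) (cst 0%E) (fun x => (g x ^+ 2)%:E).
  - by move=> n; apply/measurable_EFinP/measurable_funX.
  - exact: measurable_cst.
  - apply: filterS u0 => x ux _; apply/cvg_EFin; first exact: nearW.
    by have := cvgM ux ux; rewrite mulr0; exact.
  - exact: Lfun2_integrable_sqr.
  - apply: filterS ug => x ux n _ /=.
    rewrite lee_fin ger0_norm ?sqr_ge0// -[leLHS]real_normK ?num_real//.
    by rewrite lerXn2r// nnegrE (le_trans _ (ux n)).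
  move=> _ _; rewrite integral0.
  under eq_fun do rewrite -L2nrm_sqr//.
  by move=> /fine_cvg.
have -> : (fun n => L2nrm (u n)) = (fun n => Num.sqrt (L2nrm (u n) ^+ 2)).
  by apply/funext => n; rewrite sqrtr_sqr ger0_norm ?L2nrm_ge0.
by rewrite -sqrtr0; apply: continuous_cvg => //; exact: sqrt_continuous.
Qed.

End L2_theory.

(** * Density of bounded continuous functions *)

Section Cb_density.
Context {R : realType} {H : normedModType R}.
Variable mu : {finite_measure set (borel H) -> \bar R}.
Implicit Types f g : borel H -> R.

Lemma continuous_borel (phi : H -> R) : continuous phi ->
  measurable_fun setT (phi : borel H -> R).
Proof.
move=> /continuousP cphi; apply: (measurability _ (RGenOpens.measurableE R)).
move=> _ [_ [a [b ->] <-]]; rewrite setTI; apply: sub_sigma_algebra.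
exact/cphi/interval_open.
Qed.

Lemma L2_cst (c : R) : L2 mu (cst c).
Proof. exact: Lfun_cst. Qed.

Lemma L2_bounded f (M : R) : measurable_fun setT f ->
  {ae mu, forall x, `|f x| <= M} -> L2 mu f.
Proof. by move=> mf fM; apply: L2_dominated (L2_cst M) fM. Qed.

Lemma L2_Cb (phi : H -> R) : continuous phi -> bounded_fun phi -> L2 mu phi.
Proof.
move=> cphi [M [_ /(_ (M + 1) (ltr_pwDr ltr01 (lexx M))) bphi]].
apply: (@L2_bounded _ (M + 1)); first exact: continuous_borel.
by apply: aeW => x; exact: bphi.
Qed.

(** The closure of C_b(H) in L^2(mu). It is shown to be a closed linear subspace containing the
    indicators of open sets, then of Borel sets, then the simple functions, and finally
    everything. *)
Definition Cb_approx f := L2 mu f /\ forall e, 0 < e ->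
  exists2 phi : H -> R, continuous phi /\ bounded_fun phi &
    L2nrm mu (fun x => f x - phi x) < e.

Lemma Cb_approx_lim f : L2 mu f ->
  (forall e, 0 < e -> exists2 g, Cb_approx g & L2nrm mu (fun x => f x - g x) < e) ->
  Cb_approx f.
Proof.
move=> lf fa; split=> // e e0; have e20 : 0 < e / 2 by lra.
have [g [lg /(_ _ e20) [phi phic gphi]] fg] := fa _ e20.
exists phi => //; apply: le_lt_trans (L2nrm_triangle lf (L2_Cb phic.1 phic.2) lg) _.
lra.
Qed.

Lemma Cb_approx_cvg f (u : nat -> borel H -> R) : L2 mu f ->
  (forall n, Cb_approx (u n)) ->
  L2nrm mu (fun x => f x - u n x) @[n --> \oo] --> 0 -> Cb_approx f.
Proof.
move=> lf ua uf; apply: Cb_approx_lim => // e e0.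
have /cvgrPdist_lt /(_ _ e0) [n _ /(_ n (leqnn _))] := uf.
by rewrite sub0r normrN ger0_norm ?L2nrm_ge0// => h; exists (u n).
Qed.

Lemma Cb_approx_Cb (phi : H -> R) : continuous phi -> bounded_fun phi -> Cb_approx phi.
Proof.
move=> cphi bphi; split; first exact: L2_Cb.
move=> e e0; exists phi => //; have := L2nrmZ 0 (L2_Cb cphi bphi).
rewrite normr0 mul0r (_ : (fun=> _) = (fun x => phi x - phi x)) => [->//|].
by apply/funext => x; rewrite mul0r subrr.
Qed.

Lemma Cb_approx_lin a f g : Cb_approx f -> Cb_approx g ->
  Cb_approx (fun x => a * f x + g x).
Proof.
move=> [lf fa] [lg ga]; split; first exact: L2_lin.
(* The added 1 keeps the denominator positive when a = 0. *)
move=> e e0; have d0 : 0 < e / 2 / (`|a| + 1) by rewrite !divr_gt0// ltr_wpDl.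
have [phi [cphi bphi] fphi] := fa _ d0.
have e20 : 0 < e / 2 by lra.
have [psi [cpsi bpsi] gpsi] := ga _ e20.
exists (fun x => a * phi x + psi x).
  split; first by move=> x; apply: cvgD; [apply: cvgM; [exact: cvg_cst|exact: cphi]|exact: cpsi].
  have [M [_ bM]] := bphi; have [N [_ bN]] := bpsi.
  exists (`|a| * (M + 1) + (N + 1)); split; first exact: num_real.
  move=> t tM x _; apply: le_trans (ltW tM).
  apply: le_trans (ler_normD _ _) _; rewrite normrM lerD//.
    by rewrite ler_wpM2l// bM// ltr_pwDr.
  by rewrite bN// ltr_pwDr.
have lfp := L2B lf (L2_Cb cphi bphi); have lgp := L2B lg (L2_Cb cpsi bpsi).
rewrite (_ : (fun _ => _) = fun x => a * (f x - phi x) + (g x - psi x)); last first.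
  by apply/funext => x; ring.
apply: le_lt_trans (L2nrmD (L2Z a lfp) lgp) _; rewrite L2nrmZ//.
suff : `|a| * L2nrm mu (fun x => f x - phi x) <= e / 2 by lra.
have a1 : 0 < `|a| + 1 by rewrite ltr_wpDl.
apply: (@le_trans _ _ ((`|a| + 1) * (e / 2 / (`|a| + 1)))); last first.
  by rewrite mulrC divfK// gt_eqF.
by apply: ler_pM => //; [exact: L2nrm_ge0|rewrite lerDl|exact: ltW].
Qed.

Lemma L2_indic (A : set (borel H)) : measurable A -> L2 mu (\1_A : borel H -> R).
Proof.
move=> mA; apply: (@L2_bounded _ 1); first exact: measurable_indic.
by apply: aeW => x; rewrite indicE; case: (x \in A); rewrite ?normr1 ?normr0.
Qed.

(** The continuous functions min(n dist(x, ~U), 1) increase to the indicator of U, because the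
    distance to the closed complement is positive exactly on U. *)
Lemma Cb_approx_open (U : set H) : open U -> Cb_approx (\1_U : borel H -> R).
Proof.
move=> oU; have mU : measurable (U : set (borel H)) by exact: sub_sigma_algebra.
(* An empty complement is at infinite distance; the indicator is then the constant 1. *)
have [U0|/set0P[a Ua]] := eqVneq (~` U) set0.
  have -> : U = setT by rewrite -(setCK U) U0 setC0.
  rewrite indicT; apply: Cb_approx_Cb; first exact: cst_continuous.
  by exists 1; split => // t t1 x _ /=; rewrite normr1 ltW.
pose dst (x : H) := fine (edist_inf (~` U) x).
have fdst (x : H) : edist_inf (~` U) x \is a fin_num.
  rewrite ge0_fin_numE ?edist_inf_ge0//.
  apply: (@le_lt_trans _ _ (edist (x, a))); first by apply: ereal_inf_lbound; exists a.
  rewrite -ge0_fin_numE ?edist_ge0//; apply/edist_finP; exists (`|x - a| + 1) => /=.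
    by rewrite ltr_wpDl.
  by rewrite -ball_normE /= ltrDl.
have cdst : continuous dst.
  move=> x; apply: fine_cvg; rewrite fineK//; exact: edist_inf_continuous.
have dst_ge0 x : 0 <= dst x by rewrite fine_ge0// edist_inf_ge0.
have dstU x : U x -> 0 < dst x.
  move=> Ux; rewrite lt_neqAle dst_ge0 andbT; apply/negP => /eqP d0.
  have /nbhs_ballP[e /= e0 eU] : nbhs x U by exact: open_nbhs_nbhs.
  have : (edist_inf (~` U) x < e%:E)%E by rewrite -(fineK (fdst x)) -/(dst x) -d0 lte_fin.
  by move=> /ereal_inf_lt[_ [b Ub <-]] /edist_lt_ball /eU.
pose phi n (x : H) := Num.min (n%:R * dst x) 1.
have phi01 n x : 0 <= phi n x <= 1.
  by rewrite /phi ge_min lexx orbT andbT le_min ler01 andbT mulr_ge0.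
have cphi n : continuous (phi n).
  move=> x; apply: (@continuous_min _ _ (fun x => n%:R * dst x) (cst 1) x); last exact: cvg_cst.
  by apply: cvgM; [exact: cvg_cst|exact: cdst].
have bphi n : bounded_fun (phi n).
  exists 1; split => // t t1 x _ /=; rewrite ger0_norm; case/andP: (phi01 n x) => //.
  by move=> _ /le_trans; apply; exact: ltW.
have d01 n x : `|\1_U x - phi n x| <= 1 :> R.
  have /andP[p0 p1] := phi01 n x.
  have : 0 <= (\1_U x : R) <= 1 by rewrite indicE; case: (x \in U); rewrite ?lexx ?ler01.
  by move=> /andP[i0 i1]; rewrite ler_norml; apply/andP; split; lra.
apply: (@Cb_approx_cvg _ (fun n => phi n : borel H -> R)).
- exact: L2_indic.
- by move=> n; exact: Cb_approx_Cb.
apply: (@L2nrm_dominated_cvg0 _ _ _ mu _ (cst 1)).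
- move=> n; apply: measurable_funB; first exact: measurable_indic.
  exact: continuous_borel.
- exact: L2_cst.
- by apply: aeW => x n; exact: d01.
apply: aeW => x; have [Ux|Ux] := pselect (U x).
  apply: (@cvg_trans _ (cst (0 : R) @ \oo)); last exact: cvg_cst.
  apply: near_eq_cvg; near=> n => /=.
  rewrite indicE mem_set// /phi min_r ?subrr//.
  rewrite -ler_pdivrMr ?dstU// div1r; near: n; exact: nbhs_infty_ger.
rewrite (_ : (fun _ => _) = cst 0); first exact: cvg_cst.
apply/funext => n /=; rewrite indicE memNset// /phi /dst edist_inf0//=.
by rewrite mulr0 min_l// subrr.
Unshelve. all: by end_near. Qed.

Lemma Cb_approx_sum (s : seq nat) (u : nat -> borel H -> R) :
  (forall n, Cb_approx (u n)) -> Cb_approx (fun x => \sum_(i <- s) u i x).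
Proof.
move=> ua; elim: s => [|i s IH].
  rewrite (_ : (fun _ => _) = cst 0); last by apply/funext => x; rewrite big_nil.
  apply: Cb_approx_Cb; first exact: cst_continuous.
  by exists 0; split => // t t0 x _ /=; rewrite normr0 ltW.
rewrite (_ : (fun _ => _) = fun x => 1 * u i x + \sum_(j <- s) u j x).
  exact: Cb_approx_lin.
by apply/funext => x; rewrite big_cons mul1r.
Qed.

(** Dynkin's theorem: open sets form an intersection-stable generator, a complement has indicator 1
    - 1_S, and the indicator of a disjoint union is the L^2 limit of its partial sums. *)
Lemma Cb_approx_indic (A : set (borel H)) : measurable A -> Cb_approx (\1_A : borel H -> R).
Proof.
apply: (@dynkin_induction _ (borel H) (@open H) (fun A => Cb_approx \1_A)) => //.
- exact: openI.
- by apply: Cb_approx_open; exact: openT.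
- exact: Cb_approx_open.
- move=> S mS Sa; rewrite (_ : \1_(~` S) = fun x => -1 * \1_S x + \1_setT x).
    by apply: Cb_approx_lin => //; apply: Cb_approx_open; exact: openT.
  apply/funext => x; rewrite !indicE in_setT in_setC.
  by case: (x \in S) => /=; ring.
move=> F mF tF Fa.
apply: (@Cb_approx_cvg _ (fun n x => \sum_(0 <= i < n) \1_(F i) x)).
- by apply: L2_indic; exact: bigcup_measurable.
- by move=> n; exact: Cb_approx_sum.
(* By disjointness a point of [F k] is counted once, at index k. The partial sums thus take only the
   values 0 and 1, which gives the majorant 1 below. *)
have Fk n k x : F k x -> \sum_(0 <= i < n) \1_(F i) x = (k < n)%:R :> R.
  move=> Fkx; transitivity (\sum_(0 <= i < n | i == k) 1 : R).
    rewrite [RHS]big_mkcond; apply: eq_bigr => i _; rewrite indicE.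
    case: eqVneq => [->|ik]; first by rewrite mem_set.
    rewrite memNset// => Fix; move/trivIsetP : tF => /(_ i k I I ik).
    by apply/eqP/set0P; exists x.
  by rewrite big_nat1_eq leq0n /=; case: (k < n)%N.
have F0 n x : ~ (\bigcup_k F k) x -> \sum_(0 <= i < n) \1_(F i) x = 0 :> R.
  move=> nF; apply: big1 => i _; rewrite indicE memNset// => Fix.
  by apply: nF; exists i.
apply: (@L2nrm_dominated_cvg0 _ _ _ mu _ (cst 1)).
- move=> n; apply: measurable_funB.
    by apply: measurable_indic; exact: bigcup_measurable.
  by apply: measurable_sum => i; exact: measurable_indic.
- exact: L2_cst.
- apply: aeW => x n; rewrite [\1_(\bigcup_k _) x]indicE.
  have [|Fx] := pselect ((\bigcup_k F k) x).
    move=> /[dup] Fx [k _ /Fk ->]; rewrite mem_set//=.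
    by case: (k < n)%N; rewrite ?subrr ?normr0// subr0 normr1.
  by rewrite F0// memNset// subrr normr0.
apply: aeW => x; have [|Fx] := pselect ((\bigcup_k F k) x); last first.
  rewrite (_ : (fun _ => _) = cst 0); first exact: cvg_cst.
  by apply/funext => n; rewrite F0// indicE memNset// subrr.
move=> /[dup] Fx [k _ Fkx]; apply: (@cvg_trans _ (cst (0 : R) @ \oo)); last exact: cvg_cst.
apply: near_eq_cvg; near=> n => /=.
rewrite indicE mem_set// (Fk _ k)// (_ : (k < n)%N) ?subrr//.
near: n; exact: nbhs_infty_gt.
Unshelve. all: by end_near. Qed.

Import HBSimple HBNNSimple.

Lemma Cb_approx_nnsfun (f : {nnsfun (borel H) >-> R}) : Cb_approx f.
Proof.
rewrite (_ : (f : _ -> _) = fun x =>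
    \sum_(y <- finmap.enum_fset (fset_set (range f))) y * \1_(f @^-1` [set y]) x).
  elim: (finmap.enum_fset (fset_set (range f))) => [|y s IH].
    rewrite (_ : (fun _ => _) = cst 0); last by apply/funext => x; rewrite big_nil.
    apply: Cb_approx_Cb; first exact: cst_continuous.
    by exists 0; split => // t t0 x _ /=; rewrite normr0 ltW.
  rewrite (_ : (fun _ => _) = fun x => y * \1_(f @^-1` [set y]) x +
      \sum_(y <- s) y * \1_(f @^-1` [set y]) x); last by apply/funext => x; rewrite big_cons.
  apply: Cb_approx_lin => //; apply: Cb_approx_indic.
  exact: measurable_sfunP.
by apply/funext => x; rewrite fimfunE fsbig_finite.
Qed.

(** Simple functions increase to f from below, so the error lies between 0 and f, and f itself is
    the L^2 majorant. *)
Lemma Cb_approx_ge0 f : L2 mu f -> (forall x, 0 <= f x) -> Cb_approx f.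
Proof.
move=> lf f0; have mf : measurable_fun setT (EFin \o f).
  by apply/measurable_EFinP; exact: L2_measurable lf.
pose u n : {nnsfun (borel H) >-> R} := nnsfun_approx measurableT mf n.
have ule n x : u n x <= f x.
  by rewrite -lee_fin /u nnsfun_approxE; apply: le_approx => // y _; rewrite lee_fin.
apply: (@Cb_approx_cvg _ u) => //; first by move=> n; exact: Cb_approx_nnsfun.
apply: (@L2nrm_dominated_cvg0 _ _ _ mu _ f) => //.
- by move=> n; apply: measurable_funB => //; exact: L2_measurable lf.
- by apply: aeW => x n; rewrite ger0_norm ?subr_ge0// gerBl.
apply: aeW => x; rewrite -[X in _ --> X](subrr (f x)).
apply: cvgB; first exact: cvg_cst.
have := @cvg_nnsfun_approx _ _ _ _ measurableT _ mf (fun x _ => f0 x) x I.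
by move=> /fine_cvg.
Qed.

Lemma Cb_dense f : L2 mu f -> Cb_approx f.
Proof.
move=> lf; have mf := L2_measurable lf.
have lp : L2 mu (fun x => Num.max (f x) 0).
  apply: (@L2_dominated _ _ _ mu _ (Num.norm \o f)).
  - by apply: measurable_maxr => //; exact: measurable_cst.
  - apply: L2_of_lty; first exact: measurableT_comp.
    rewrite /L2norm (_ : EFin \o _ = abse \o (EFin \o f))//.
    by rewrite Lnorm_abse; exact: L2_lty.
  - apply: aeW => x /=; rewrite ger0_norm ?le_max ?lexx ?orbT//.
    by rewrite ge_max ler_norm normr_ge0.
have ln : L2 mu (fun x => Num.max (f x) 0 - f x) by exact: L2B.
rewrite (_ : f = fun x => -1 * (Num.max (f x) 0 - f x) + Num.max (f x) 0).
  by apply: Cb_approx_lin; apply: Cb_approx_ge0 => // x; rewrite ?subr_ge0 le_max ?lexx ?orbT.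
by apply/funext => x; ring.
Qed.

End Cb_density.

(** * Integrals off a null set and Riemann sums *)

Section integral_off_null_set.
Context {R : realType} {d : measure_display} {T : measurableType d}.
Variable m : {measure set T -> \bar R}.

Import HBSimple HBNNSimple.

(** The integral of a nonnegative function, measurable or not, is the supremum of the integrals of
    the simple functions below it. Setting such a simple function to 0 on N keeps its integral and
    puts it below g. *)
Lemma ge0_le_integral_off_null (f g : T -> \bar R) (N : set T) :
  measurable N -> m N = 0%E -> (forall x, (0 <= f x)%E) -> (forall x, (0 <= g x)%E) ->
  (forall x, ~ N x -> (f x <= g x)%E) -> (\int[m]_x f x <= \int[m]_x g x)%E.
Proof.
move=> mN N0 f0 g0 fg; have mNC := measurableC mN.
rewrite !ge0_integralTE//; apply: ge_ereal_sup => /= _ -[h /= hf <-].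
have -> : sintegral m h = sintegral m (proj_nnsfun h mNC).
  rewrite -!integralT_nnsfun; apply: ae_eq_integral => //.
  - exact/measurable_EFinP.
  - exact/measurable_EFinP.
  exists N; split => // x /= /not_implyP[_]; apply: contra_notP => Nx.
  by rewrite mindicE mem_set// mulr1.
apply: ereal_sup_ubound; exists (proj_nnsfun h mNC) => //= x.
rewrite mindicE; have [Nx|Nx] := pselect (N x).
  by rewrite memNset ?mulr0// => /(_ Nx).
by rewrite mem_set// mulr1; exact: le_trans (hf x) (fg _ Nx).
Qed.

(* The paths of X are continuous only almost surely, so that the Feynman-Kac
   integrand need not be measurable: the integrals are compared through the
   simple functions below them. *)
Lemma Rintegral_eq_off_null (f g : T -> R) (N : set T) :
  measurable N -> m N = 0%E -> (forall x, ~ N x -> f x = g x) ->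
  \int[m]_x f x = \int[m]_x g x.
Proof.
move=> mN N0 fg; rewrite /Rintegral; congr fine; rewrite integralE [RHS]integralE.
congr (_ - _)%E; apply/eqP; rewrite eq_le; apply/andP; split;
  by apply: (ge0_le_integral_off_null mN) => // x Nx; rewrite ?funeposE ?funenegE /= fg.
Qed.

End integral_off_null_set.

Section riemann.
Context {R : realType}.
Notation leb := (@lebesgue_measure R).

Definition riemann_sum (v : R -> R) (t : R) (n : nat) : R :=
  \sum_(i < n.+1) v (t / n.+1%:R * i%:R) * (t / n.+1%:R).

(* Makes the time integral of V(X_s) a measurable function on Omega. *)
Lemma riemann_cvg (v : R -> R) (t M : R) : 0 < t ->
  continuous v -> (forall s, `|v s| <= M) ->
  riemann_sum v t n @[n --> \oo] --> \int[leb]_(s in `[0, t]) v s.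
Proof.
move=> t0 cv vM.
pose dl n : R := t / n.+1%:R.
have dl0 n : 0 < dl n by rewrite divr_gt0.
have dlt n : dl n * n.+1%:R = t by rewrite /dl divfK.
pose I n i := `[dl n * i%:R, dl n * i.+1%:R[%classic.
(* The left-endpoint step function: at s it takes the value of v at a point within t / (n + 1) of s,
   so continuity of v gives pointwise convergence. *)
pose vn n s : R := \sum_(i < n.+1) v (dl n * i%:R) * \1_(I n i) s.
have iv : leb.-integrable `[0, t] (EFin \o v).
  apply: continuous_compact_integrable => //; first exact: segment_compact.
  exact: continuous_subspaceT.
have vnE n s : 0 <= s < t -> exists2 r, vn n s = v r & `|r - s| <= dl n.
  move=> /andP[s0 st]; pose k := Num.truncn (s / dl n).
  have /andP[ks sk] : k%:R <= s / dl n < k.+1%:R by apply: truncn_itv; rewrite divr_ge0// ltW.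
  rewrite ler_pdivlMr// in ks; rewrite ltr_pdivrMr// in sk.
  have kn : (k < n.+1)%N.
    by rewrite -(ltr_nat R) -(ltr_pM2r (dl0 n)); apply: le_lt_trans ks _; rewrite mulrC dlt.
  exists (dl n * k%:R); last first.
    by rewrite -natr1 mulrDl mul1r in sk; rewrite mulrC ler_norml; apply/andP; split; have := dl0 n; lra.
  rewrite /vn (bigD1 (Ordinal kn))//= big1 ?addr0.
    by rewrite indicE mem_set ?mulr1// /I /= in_itv/= ![dl n * _]mulrC ks.
  move=> i; rewrite -val_eqE /= => ik; rewrite indicE memNset ?mulr0//.
  rewrite /I /= in_itv/= ![dl n * _]mulrC => /andP[a b].
  move: ik; rewrite neq_ltn => /orP[ik|ki].
    have le1 : i.+1%:R * dl n <= k%:R * dl n by rewrite ler_pM2r// ler_nat.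
    by have := lt_le_trans b (le_trans le1 ks); rewrite ltxx.
  have le1 : k.+1%:R * dl n <= i%:R * dl n by rewrite ler_pM2r// ler_nat.
  by have := lt_le_trans sk (le_trans le1 a); rewrite ltxx.
(* The cells [I n i] tile [0, t[ and leave out t, so the limit is taken on the half-open interval
   and the endpoint, a null set, is put back at the end. *)
have mI : measurable (`[0, t[%classic : set (measurableTypeR R)) by exact: measurable_itv.
have [] := @dominated_convergence _ _ _ leb `[0, t[%classic mI
    (fun n s => (vn n s)%:E) (EFin \o v) (cst M%:E).
- move=> n; apply/measurable_EFinP; apply: measurable_sum => i.
  by apply: measurable_funM => //; apply: measurable_indic; exact: measurable_itv.
- apply: measurable_int; apply: integrableS iv => //.
  by apply: subset_itvl; rewrite bnd_simp.
- apply: aeW => s; rewrite /= in_itv/= => st; apply/cvg_EFin; first exact: nearW.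
  apply/cvgrPdist_lt => e e0 /=.
  have /cvgrPdist_lt /(_ _ e0) /nbhs_ballP[r /= r0 rv] := cv s.
  have dl_cvg : dl n @[n --> \oo] --> 0.
    by rewrite -(mulr0 t); apply: cvgM; [exact: cvg_cst|exact: cvg_harmonic].
  move/cvgrPdist_lt : dl_cvg => /(_ _ r0); apply: filterS => n.
  rewrite sub0r normrN gtr0_norm// => dr.
  have [q -> qs] := vnE n s st; apply: rv; rewrite /ball /= distrC.
  exact: le_lt_trans dr.
- apply/integrableP; split; first exact: measurable_cst.
  rewrite integral_cst//= lebesgue_measure_itv/= lte_fin t0.
  by rewrite -EFinD -EFinM ltry.
- apply: aeW => s n; rewrite /= in_itv/= => st; rewrite lee_fin.
  by have [r -> _] := vnE n s st.
move=> _ _ vncvg.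
have E n : (\int[leb]_(s in `[0%R, t[) (vn n s)%:E = (riemann_sum v t n)%:E)%E.
  under eq_integral do rewrite /vn -sumEFin.
  have ii i : leb.-integrable `[0, t[ (EFin \o (fun s => \1_(I n i) s)).
    by apply: integrableS (integrable_indic_itv _ _ true true).
  rewrite integral_sum//; last first.
    by move=> i; exact: (integrableZl mI (v (dl n * i%:R)) (ii i)).
  rewrite /riemann_sum -sumEFin; apply: eq_bigr => i _.
  rewrite (@integralZl _ _ _ leb _ mI _ (ii i) (v (dl n * i%:R))).
  rewrite integral_indic//; last exact: measurable_itv.
  rewrite setIidl; last first.
    apply: subset_itv; rewrite bnd_simp; first by rewrite mulr_ge0// ltW.
    by rewrite -(dlt n) ler_pM2l// ler_nat.
  rewrite /I /= lebesgue_measure_itv/= lte_fin ltr_pM2l// ltr_nat ltnSn.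
  rewrite -EFinD EFinM; congr (_ * _%:E)%E.
  by rewrite -natr1 -/(dl n); ring.
have iv' : leb.-integrable `[0, t[ (EFin \o v).
  by apply: integrableS iv => //; apply: subset_itvl; rewrite bnd_simp.
rewrite -Rintegral_itv_bndo_bndc//.
have := vncvg; rewrite -(fineK (integrable_fin_num mI iv')) => /fine_cvg.
by apply: cvg_trans; apply: near_eq_cvg; apply: nearW => n /=; rewrite E.
Qed.

(** If v s > 0, continuity keeps v above v s / 2 on some [s, b] inside [0, t], and the integral is
    at least (v s / 2)(b - s) > 0. The condition s < t leaves room to the right of s. *)
Lemma Rintegral_eq0_continuous (v : R -> R) (t : R) : continuous v -> (forall s, 0 <= v s) ->
  \int[leb]_(s in `[0, t]) v s = 0 -> forall s, 0 <= s < t -> v s = 0.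
Proof.
move=> cv v0 iv0 s /andP[s0 st]; apply/eqP; apply/negP => /negP vs.
have {}vs : 0 < v s by rewrite lt_neqAle eq_sym vs v0.
have vs2 : 0 < v s / 2 by rewrite divr_gt0.
have /cvgrPdist_lt /(_ _ vs2) /nbhs_ballP[r /= r0 rv] := cv s.
pose b := Num.min t (s + r / 2).
have sb : s < b by rewrite /b lt_min st ltrDl divr_gt0.
have iv : leb.-integrable `[0, t] (EFin \o v).
  apply: continuous_compact_integrable => //; first exact: segment_compact.
  exact: continuous_subspaceT.
have mI : measurable (`[0, t]%classic : set (measurableTypeR R)) by exact: measurable_itv.
have mJ : measurable (`[s, b]%classic : set (measurableTypeR R)) by exact: measurable_itv.
have ie0 : (\int[leb]_(x in `[0%R, t]) (v x)%:E = 0)%E.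
  have := fineK (integrable_fin_num mI iv).
  by rewrite -/(Rintegral leb `[0%R, t] v) iv0 => <-.
have JI : `[s, b] `<=` `[0, t].
  by apply: subset_itv; rewrite bnd_simp// /b ge_min lexx.
have : (((v s / 2) * (b - s))%:E <= \int[leb]_(x in `[0%R, t]) (v x)%:E)%E.
  apply: (@le_trans _ _ (\int[leb]_(x in `[s, b]) (v x)%:E)%E); last first.
    apply: ge0_subset_integral => //; last by move=> x _; rewrite lee_fin.
    exact: measurable_int iv.
  have -> : ((v s / 2 * (b - s))%:E = \int[leb]_(x in `[s, b]) (cst (v s / 2)%:E x))%E.
    by rewrite integral_cst//= lebesgue_measure_itv/= lte_fin sb -EFinD EFinM.
  apply: ge0_le_integral => //.
  - by move=> x _; rewrite lee_fin ltW.
  - exact: measurable_int (integrableS mI mJ JI iv).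
  move=> x; rewrite /= in_itv/= => /andP[sx xb]; rewrite lee_fin.
  have xr : `|s - x| < r.
    have : b <= s + r / 2 by rewrite /b ge_min lexx orbT.
    by move=> ?; rewrite ler0_norm; lra.
  by have := rv x xr; rewrite ltr_norml => /andP[_]; lra.
rewrite ie0 lee_fin leNgt => /negP; apply; rewrite mulr_gt0// subr_gt0//.
Qed.

End riemann.

(** * The Feynman-Kac limit *)

Lemma continuous_max0 {R : realType} : continuous (fun s : R => Num.max s 0).
Proof.
by move=> s; apply: (@continuous_max _ _ id (cst 0) s); [exact: cvg_id|exact: cvg_cst].
Qed.

(** Freezing a path at its initial value for negative times turns continuity on [0, +oo[ into
    continuity on the line, the form that the Riemann sum lemmas use, without changing the path at
    times s >= 0. *)
Lemma within_continuous_max0 {R : realType} {T : topologicalType} (g : R -> T) :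
  {within `[0, +oo[, continuous g} -> continuous (fun s : R => g (Num.max s 0)).
Proof.
move=> cg s; have s0 : `[0, +oo[%classic (Num.max s 0).
  by rewrite /= in_itv/= andbT le_max lexx orbT.
apply: (@cvg_comp _ _ _ (fun s : R => Num.max s 0) g _ (within `[0, +oo[%classic (nbhs (Num.max s 0)))).
  move=> A wA; have := @continuous_max0 R s _ wA; apply: (@filterS _ (nbhs s)) => r rA; apply: rA.
  by rewrite /= in_itv/= andbT le_max lexx orbT.
by have := cg (Num.max s 0); rewrite (nbhs_subspace_in s0).
Qed.

Lemma expRN_le_inv {R : realType} (y : R) : 0 < y -> expR (- y) <= y^-1.
Proof.
move=> y0; rewrite expRN lef_pV2 ?posrE ?expR_gt0//.
by apply: le_trans (expR_ge1Dx y); rewrite lerDr.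
Qed.

(** For z > 0 the exponential is at most eps n / z; for z = 0 it is constantly 1. This is how the
    penalization becomes an indicator. *)
Lemma cvg_expR_penalty {R : realType} (eps : nat -> R) (z : R) :
  (forall n, 0 < eps n) -> eps n @[n --> \oo] --> 0 -> 0 <= z ->
  expR (- ((eps n)^-1 * z)) @[n --> \oo] --> ((z == 0)%:R : R).
Proof.
move=> e0 ec; rewrite le_eqVlt => /predU1P[<-|z0].
  rewrite eqxx (_ : (fun _ => _) = cst 1); first exact: cvg_cst.
  by apply/funext => n; rewrite mulr0 oppr0 expR0.
rewrite gt_eqF//; apply: (@squeeze_cvgr _ _ _ _ (cst 0) (fun n => z^-1 * eps n)).
- apply: nearW => n /=; rewrite expR_ge0/=.
  apply: le_trans (expRN_le_inv _) _; first by rewrite mulr_gt0// invr_gt0.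
  by rewrite invfM invrK mulrC.
- exact: cvg_cst.
- have h : z^-1 * eps n @[n --> \oo] --> z^-1 * 0 by apply: cvgM => //; exact: cvg_cst.
  by rewrite mulr0 in h.
Qed.

Section feynman_kac_limit.
Context {R : realType} {H : completeNormedModType R}.
Context {d : measure_display} {Omega : measurableType d}.
Variables (Pr : probability Omega R) (X : R -> H -> Omega -> H) (x : H).
Hypothesis mX : forall (t : R) (B : set (borel H)), 0 <= t -> measurable B ->
  measurable (X t x @^-1` B).
Hypothesis cX : {ae Pr, forall w, {within `[0, +oo[, continuous (fun t => X t x w)}}.
Variables (K : set H) (V : H -> R).
Hypotheses (cV : continuous V) (bV : bounded_fun V).
Hypotheses (V0 : forall y, K y -> V y = 0) (Vgt0 : forall y, (~` K) y -> 0 < V y).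
Notation leb := (@lebesgue_measure R).

Let V_ge0 y : 0 <= V y.
Proof. by have [/V0 ->//|/Vgt0 /ltW] := pselect (K y). Qed.

Lemma exit_time_geP (t : R) (w : Omega) : 0 < t ->
  {within `[0, +oo[, continuous (fun t => X t x w)} ->
  (t%:E <= exit_time X K x w)%E = (\int[leb]_(s in `[0, t]) V (X s x w) == 0).
Proof.
move=> t0 cXw; pose v s := V (X (Num.max s 0) x w).
have cv : continuous v.
  move=> s; apply: (@cvg_comp _ _ _ (fun s : R => X (Num.max s 0) x w) V).
    exact: (within_continuous_max0 cXw).
  exact: cV.
have vE s : 0 <= s -> V (X s x w) = v s by move=> s0; rewrite /v max_l.
have -> : \int[leb]_(s in `[0, t]) V (X s x w) = \int[leb]_(s in `[0, t]) v s.
  by apply: eq_Rintegral => s; rewrite inE /= in_itv/= => /andP[s0 _]; exact: vE.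
apply/idP/eqP => [tE|iv0].
  have iv : leb.-integrable `[0, t] (EFin \o v).
    apply: continuous_compact_integrable => //; first exact: segment_compact.
    exact: continuous_subspaceT.
  (* The bound tau_x >= t places the path in K at each time s < t; time t itself is negligible for
     the integral. *)
  rewrite -Rintegral_itv_bndo_bndc; last first.
    by apply: integrableS iv => //; apply: subset_itvl; rewrite bnd_simp.
  transitivity (\int[leb]_(s in `[0, t[) (cst (0 : R) s)); last first.
    by rewrite /Rintegral integral0.
  apply: eq_Rintegral => s; rewrite inE /= in_itv/= => /andP[s0 st].
  rewrite -vE//; apply: V0; apply: contrapT => nK.
  have : (exit_time X K x w <= s%:E)%E.
    by apply: ereal_inf_lbound; exists s.
  by move=> /(le_trans tE); rewrite lee_fin leNgt st.
(* It is enough that t bounds every exit instant from below: an instant s < t outside K would give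
   V(X_s) > 0, against the vanishing integral. *)
apply: le_ereal_inf_tmp => _ [s [s0 nK] <-]; rewrite lee_fin leNgt; apply/negP => st.
have := Rintegral_eq0_continuous cv (fun s => V_ge0 _) iv0.
move=> /(_ s); rewrite s0 st => /(_ isT); rewrite -vE// => Vs.
by have := Vgt0 nK; rewrite Vs ltxx.
Qed.

Lemma feynman_kac_cvg (t : R) (phi : H -> R) (eps : nat -> R) :
  0 < t -> continuous phi -> bounded_fun phi ->
  (forall n, 0 < eps n) -> eps n @[n --> \oo] --> 0 ->
  feynman_kac Pr X V (eps n) t phi x @[n --> \oo] --> killed_expectation Pr X K t phi x.
Proof.
move=> t0 cphi [M [_ /(_ (M + 1) (ltr_pwDr ltr01 (lexx M))) bphi]] e0 ec.
have [MV bMV] : exists MV, forall y, `|V y| <= MV.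
  have [MV [_ /(_ (MV + 1) (ltr_pwDr ltr01 (lexx MV))) h]] := bV.
  by exists (MV + 1) => y; exact: h.
have mXf s : 0 <= s -> measurable_fun setT (X s x : Omega -> borel H).
  by move=> s0 _ B mB; rewrite setTI; exact: mX.
have mcomp (psi : H -> R) s : 0 <= s -> continuous psi ->
    measurable_fun setT (fun w => psi (X s x w)).
  by move=> s0 cpsi; exact: (measurableT_comp (continuous_borel cpsi) (mXf s s0)).
case: cX => N [mN N0 cN].
have {}cN w : ~ N w -> {within `[0, +oo[, continuous (fun t => X t x w)}.
  by move=> Nw; apply: contrapT => h; exact/Nw/cN.
(* Off N the time integral is a limit of Riemann sums of the measurable [V (X s x w)]. Setting it to
   0 on N makes [Z] measurable on all of Omega, and both expectations may be computed with [Z]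
   instead. *)
pose Z w := \1_(~` N) w * \int[leb]_(s in `[0, t]) V (X s x w).
have Z_ge0 w : 0 <= Z w.
  by rewrite mulr_ge0//; apply: Rintegral_ge0.
have mZ : measurable_fun setT Z.
  apply: (@measurable_fun_cvg _ _ _ _
    (fun n w => \1_(~` N) w * riemann_sum (fun s => V (X (Num.max s 0) x w)) t n)).
    move=> n; apply: measurable_funM; first by apply: measurable_indic; exact: measurableC.
    apply: measurable_sum => i; apply: measurable_funM => //.
    by apply: mcomp => //; rewrite le_max lexx orbT.
  move=> w _; have [Nw|Nw] := pselect (N w).
    rewrite /Z indicE memNset// mul0r; under eq_fun do rewrite mul0r; exact: cvg_cst.
  apply: cvgM; first exact: cvg_cst.
  have -> : \int[leb]_(s in `[0, t]) V (X s x w) =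
      \int[leb]_(s in `[0, t]) V (X (Num.max s 0) x w).
    apply: eq_Rintegral => s; rewrite inE /= in_itv/= => /andP[s0 _].
    by rewrite max_l.
  apply: (@riemann_cvg _ _ _ MV) => // s.
  apply: (@cvg_comp _ _ _ (fun s : R => X (Num.max s 0) x w) V); last exact: cV.
  exact: (within_continuous_max0 (cN _ Nw)).
pose g n w := phi (X t x w) * expR (- ((eps n)^-1 * Z w)).
pose gl w := phi (X t x w) * (Z w == 0)%:R.
have ZE w : ~ N w -> Z w = \int[leb]_(s in `[0, t]) V (X s x w).
  by move=> Nw; rewrite /Z indicE mem_set// mul1r.
have -> : killed_expectation Pr X K t phi x = \int[Pr]_w gl w.
  apply: (Rintegral_eq_off_null mN) => // w Nw.
  rewrite /gl ZE// -exit_time_geP//; last exact: cN.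
  by rewrite indicE; congr (_ * _%:R); congr nat_of_bool; apply/idP/idP; rewrite inE.
have -> : (fun n => feynman_kac Pr X V (eps n) t phi x) = (fun n => \int[Pr]_w g n w).
  by apply/funext => n; apply: (Rintegral_eq_off_null mN) => // w Nw; rewrite /g ZE.
have mg n : measurable_fun setT (g n).
  apply: measurable_funM; first exact: mcomp (ltW t0) cphi.
  apply: measurableT_comp => //; apply: measurableT_comp => //.
  exact: measurable_funM.
have gcvg w : g n w @[n --> \oo] --> gl w.
  by apply: cvgM; [exact: cvg_cst|exact: cvg_expR_penalty].
have mgl : measurable_fun setT gl by apply: measurable_fun_cvg mg _ => w _; exact: gcvg.
have Mg w n : `|g n w| <= M + 1.
  rewrite normrM -[leRHS]mulr1 ler_pM//; first exact: bphi.
  by rewrite ger0_norm ?expR_ge0// -expR0 ler_expR oppr_le0 mulr_ge0// invr_ge0 ltW.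
have [] := @dominated_convergence _ _ _ Pr setT measurableT
    (fun n w => (g n w)%:E) (EFin \o gl) (cst (M + 1)%:E).
- by move=> n; exact/measurable_EFinP.
- exact/measurable_EFinP.
- by apply: aeW => w _; apply/cvg_EFin; [exact: nearW|exact: gcvg].
- exact: finite_measure_integrable_cst.
- by apply: aeW => w n _; rewrite lee_fin; exact: Mg.
move=> igl _.
by rewrite -(fineK (integrable_fin_num measurableT igl)) => /fine_cvg.
Qed.

End feynman_kac_limit.

(** * Laplace transforms of contraction semigroups *)

Section L2_lim0_norm.
Context {R : realType} {d : measure_display} {E : measurableType d}.
Variable m : {measure set E -> \bar R}.

Lemma L2_lim0P (u : R -> E -> R) (w : E -> R) :
  (forall eps, 0 < eps -> L2 m (u eps)) -> L2 m w ->
  L2_lim0 m u w <-> L2nrm m (fun x => u eps x - w x) @[eps --> 0^'+] --> 0.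
Proof.
move=> lu lw; rewrite /L2_lim0; split => [/fine_cvg//|h].
suff : (L2nrm m (u eps \- w))%:E @[eps --> 0^'+] --> 0%E.
  apply: cvg_trans; apply: near_eq_cvg; near=> eps.
  by rewrite L2nrmE//; apply: L2B => //; apply: lu; near: eps; exact: nbhs_right_gt.
by apply/cvg_EFin; [exact: nearW|exact: h].
Unshelve. all: by end_near. Qed.

(** Right limits at 0 in the reals are sequential, which gives access to dominated convergence and
    to countable unions of null sets. *)
Lemma L2_lim0_seq (u : R -> E -> R) (w : E -> R) :
  (forall eps, 0 < eps -> L2 m (u eps)) -> L2 m w ->
  (forall eps : nat -> R, (forall n, 0 < eps n) -> eps n @[n --> \oo] --> 0 ->
    L2nrm m (fun x => u (eps n) x - w x) @[n --> \oo] --> 0) ->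
  L2_lim0 m u w.
Proof.
move=> lu lw h; apply/L2_lim0P => //; apply/cvg_at_rightP => eps [e0 ec].
exact: h.
Qed.

End L2_lim0_norm.

(** * Orbits of a contraction semigroup: linearity, continuity, weak differentiability *)

Section contraction_semigroup_theory.
Context {R : realType} {d : measure_display} {E : measurableType d}.
Variable m : {measure set E -> \bar R}.
Variable P : R -> (E -> R) -> E -> R.
Hypothesis sP : contraction_semigroup m P.
Implicit Types f g u v : E -> R.

Lemma semigroup_L2nrm t f : 0 <= t -> L2 m f -> L2nrm m (P t f) <= L2nrm m f.
Proof.
move=> t0 lf; rewrite -lee_fin -!L2nrmE//; last exact: semigroup_L2.
exact: semigroup_contraction.
Qed.

Lemma semigroupB t f g : 0 <= t -> L2 m f -> L2 m g ->
  {ae m, forall x, P t (fun y => f y - g y) x = P t f x - P t g x}.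
Proof.
move=> t0 lf lg; have := semigroup_linear sP (-1) t0 lg lf.
rewrite (_ : -1 \*: g \+ f = (fun y => f y - g y)); last first.
  by apply/funext => y /=; rewrite scaleN1r addrC.
by apply: filterS => x ->; ring.
Qed.

Lemma semigroupZ t a f : 0 <= t -> L2 m f ->
  {ae m, forall x, P t (fun y => a * f y) x = a * P t f x}.
Proof.
move=> t0 lf; have l0 : L2 m (cst 0 : E -> R).
  have := L2Z 0 lf; rewrite (_ : (fun _ => _) = cst 0)//.
  by apply/funext => x; rewrite mul0r.
have := semigroup_linear sP a t0 lf l0.
rewrite (_ : a \*: f \+ cst 0 = (fun x => a * f x)); last first.
  by apply/funext => x /=; rewrite addr0.
(* Linearity at 1 * 0 + 0 reads P(t) 0 = 2 P(t) 0, hence P(t) 0 = 0 almost everywhere. *)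
have := semigroup_linear sP 1 t0 l0 l0.
rewrite (_ : 1 \*: cst 0 \+ cst 0 = cst 0 :> (E -> R)); last first.
  by apply/funext => x /=; rewrite scaler0 addr0.
by apply: filterS2 => x; lra.
Qed.

Lemma semigroup_dist t f g : 0 <= t -> L2 m f -> L2 m g ->
  L2nrm m (fun x => P t f x - P t g x) <= L2nrm m (fun x => f x - g x).
Proof.
move=> t0 lf lg; have lP := semigroup_L2 sP t0.
have <- := L2nrm_ae_eq (lP _ (L2B lf lg)) (L2B (lP _ lf) (lP _ lg)) (semigroupB t0 lf lg).
by apply: semigroup_L2nrm => //; exact: L2B.
Qed.

Hypothesis cP : strongly_continuous m P.

(** Contractivity gives |P(s + h) f - P(s) f| <= |P(h) f - f|, so strong continuity at 0 yields a
    modulus of continuity uniform in time. *)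
Lemma semigroup_modulus f (e : R) : L2 m f -> 0 < e ->
  exists2 r, 0 < r & forall s t, 0 <= s -> 0 <= t -> `|s - t| < r ->
    L2nrm m (fun x => P s f x - P t f x) < e.
Proof.
move=> lf e0; have lP t := @semigroup_L2 _ _ _ _ _ sP t f.
have /L2_lim0P h := cP lf.
have /cvgrPdist_lt /(_ _ e0) [r /= r0 rP] := h (fun t t0 => lP _ (ltW t0) lf) lf.
have key s h' : 0 <= s -> 0 <= h' -> h' < r ->
    L2nrm m (fun x => P (s + h') f x - P s f x) < e.
  (* The right limit at 0 says nothing at h' = 0, where the difference is identically 0. *)
  move=> s0; rewrite le_eqVlt => /predU1P[<-|h0] hr.
    rewrite addr0 (_ : (fun _ => _) = fun x => 0 * f x).
      by rewrite L2nrmZ// normr0 mul0r.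
    by apply/funext => x; rewrite subrr mul0r.
  have lh := lP _ (ltW h0) lf.
  have -> : L2nrm m (fun x => P (s + h') f x - P s f x) =
      L2nrm m (fun x => P s (P h' f) x - P s f x).
    apply: L2nrm_ae_eq; [apply: L2B; apply: lP => //; exact: addr_ge0 (ltW _)|
      by apply: L2B; apply: (semigroup_L2 sP)|].
    by have := semigroup_D sP s0 (ltW h0) lf; apply: filterS => x ->.
  apply: le_lt_trans (semigroup_dist s0 lh lf) _.
  have := rP h'; rewrite /ball /= !sub0r !normrN gtr0_norm// => /(_ hr h0).
  by rewrite ger0_norm// L2nrm_ge0.
exists r => // s t s0 t0 st.
have [ts|/ltW st'] := leP t s.
  have := key t (s - t) t0; rewrite subrKC; apply; rewrite ?subr_ge0//.
  by move: st; rewrite ger0_norm// subr_ge0.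
rewrite L2nrmC; [|exact: lP..].
have := key s (t - s) s0; rewrite subrKC; apply; rewrite ?subr_ge0//.
by move: st; rewrite distrC ger0_norm// subr_ge0.
Qed.

(* [Num.max s 0] makes the orbits continuous on the whole line. *)
Lemma semigroup_cvg f t : L2 m f ->
  L2nrm m (fun x => P (Num.max s 0) f x - P (Num.max t 0) f x) @[s --> t] --> 0.
Proof.
move=> lf; apply/cvgrPdist_lt => e e0; have [r r0 h] := semigroup_modulus lf e0.
have rt : nbhs t (ball t r) by exact: nbhsx_ballx.
apply: filterS rt => s st; rewrite sub0r normrN ger0_norm ?L2nrm_ge0//.
apply: h; rewrite ?le_max ?lexx ?orbT//.
apply: le_lt_trans st; rewrite distrC.
have : `|Num.max t 0 - Num.max s 0| <= `|t - s|.
  have := ler_norm (t - s); have := ler_norm (- (t - s)); rewrite normrN.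
  move: (`|t - s|) => r' h1 h2; rewrite ler_norml /Num.max.
  by case: ltP => a; case: ltP => b; apply/andP; split; lra.
by [].
Qed.


Variables (u v : E -> R).
Hypothesis guv : generator m P u v.
Variable g : E -> R.
Hypothesis lg : L2 m g.

Let lu : L2 m u. Proof. by case: guv. Qed.
Let lv : L2 m v. Proof. by case: guv. Qed.
Let lP t f : 0 <= t -> L2 m f -> L2 m (P t f).
Proof. by move=> t0; exact: semigroup_L2. Qed.
Let max0 (s : R) : 0 <= Num.max s 0. Proof. by rewrite le_max lexx orbT. Qed.

Lemma orbit_continuous f : L2 m f ->
  continuous (fun s : R => L2dot m (P (Num.max s 0) f) g).
Proof.
move=> lf t; apply/cvgrPdist_le => e e0.
have e1 : 0 < e / (L2nrm m g + 1) by rewrite divr_gt0// ltr_wpDl// L2nrm_ge0.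
have /cvgrPdist_lt /(_ _ e1) := semigroup_cvg t lf.
apply: filterS => s; rewrite sub0r normrN ger0_norm ?L2nrm_ge0// => /ltW se.
rewrite distrC; apply: le_trans (L2dot_dist (lP (max0 _) lf) (lP (max0 _) lf) lg) _.
apply: (@le_trans _ _ (e / (L2nrm m g + 1) * (L2nrm m g + 1))); last first.
  by rewrite divfK// gt_eqF// ltr_wpDl// L2nrm_ge0.
by apply: ler_pM => //; rewrite ?L2nrm_ge0// lerDl.
Qed.

(* The right difference quotient of the orbit converges uniformly in time, which
   also controls the left one. *)
Lemma orbit_increment s h : 0 <= s -> 0 < h ->
  `|L2dot m (P (s + h) u) g - L2dot m (P s u) g - h * L2dot m (P s v) g| <=
  h * (L2nrm m (fun x => h^-1 * (P h u x - u x) - v x) * L2nrm m g).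
Proof.
move=> s0 h0; have h0' := ltW h0.
have lq : L2 m (fun x => P h u x - u x) by apply: L2B => //; exact: lP.
have lhv : L2 m (fun x => h * v x) by exact: L2Z.
have lqv : L2 m (fun x => (P h u x - u x) - h * v x) by exact: L2B.
(* The quantity to bound is P(s) applied to the defect P(h) u - u - h v and tested against g;
   contractivity of P(s) then makes the bound independent of s. *)
have E1 : L2dot m (P s (fun x => (P h u x - u x) - h * v x)) g =
    L2dot m (P (s + h) u) g - L2dot m (P s u) g - h * L2dot m (P s v) g.
  have lPs f : L2 m f -> L2 m (P s f) by exact: lP.
  rewrite (L2dot_ae_eq (lPs _ lqv) (L2B (lPs _ lq) (lPs _ lhv)) lg (semigroupB s0 lq lhv)).
  rewrite L2dotBl//; [|exact: lPs..]; congr (_ - _).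
    have lPh := lP h0' lu.
    rewrite (L2dot_ae_eq (lPs _ lq) (L2B (lPs _ lPh) (lPs _ lu)) lg (semigroupB s0 lPh lu)).
    rewrite L2dotBl//; [|exact: lPs..]; congr (_ - _).
    apply: L2dot_ae_eq => //; [exact: lPs|by apply: lP => //; exact: addr_ge0|].
    by have := semigroup_D sP s0 h0' lu; apply: filterS => x ->.
  rewrite -L2dotZl//; last exact: lPs.
  apply: L2dot_ae_eq => //; [exact: lPs|by apply: L2Z; exact: lPs|].
  exact: semigroupZ.
rewrite -E1; apply: le_trans (L2dot_le (lP s0 lqv) lg) _.
rewrite mulrA; apply: ler_wpM2r; first exact: L2nrm_ge0.
apply: le_trans (semigroup_L2nrm s0 lqv) _.
rewrite -[X in X * _](gtr0_norm h0) -L2nrmZ; last first.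
  by apply: L2B => //; exact: L2Z.
rewrite le_eqVlt; apply/orP; left; apply/eqP; congr L2nrm; apply/funext => x.
by field; rewrite gt_eqF.
Qed.

Lemma orbit_derive (t : R) : 0 < t ->
  is_derive t (1 : R) (fun s : R => L2dot m (P (Num.max s 0) u) g)
    (L2dot m (P (Num.max t 0) v) g).
Proof.
move=> t0; set J := (fun s : R => L2dot m (P (Num.max s 0) u) g).
set j := (fun s : R => L2dot m (P (Num.max s 0) v) g).
have h : h^-1 *: (J (h *: (1 : R) + t) - J t) @[h --> 0^'] --> j t.
  apply/cvgrPdist_lt => e e0.
  have [lQ cQ] : (forall h, 0 < h -> L2 m (fun x => h^-1 * (P h u x - u x))) /\
      L2_lim0 m (fun h x => h^-1 * (P h u x - u x)) v.
    split; last by case: guv.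
    by move=> h h0; apply/L2Z/L2B => //; exact/lP/lu/ltW.
  have e1 : 0 < e / 2 / (L2nrm m g + 1) by rewrite !divr_gt0// ltr_wpDl// L2nrm_ge0.
  have e2 : 0 < e / 2 by rewrite divr_gt0.
  have /cvgrPdist_lt /(_ _ e1) [r /= r0 rQ] := (L2_lim0P lQ lv).1 cQ.
  have /cvgrPdist_lt /(_ _ e2) /nbhs_ballP[q /= q0 qj] := @orbit_continuous v lv t.
  (* The radius t keeps the times nonnegative, r controls the difference quotient and q the
     oscillation of [j] around t. *)
  exists (Num.min t (Num.min r q)); first by rewrite /= !lt_min t0 r0 q0.
  move=> h; rewrite /ball /= sub0r normrN !lt_min => /and3P[ht hr hq] h0.
  (* The earlier of the two times. For h < 0 the increment is seen from t + h as a right increment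
     of length |h|, and continuity of [j] carries the slope from [a] to t. *)
  pose a := Num.min t (t + h).
  have a0 : 0 <= a.
    by rewrite le_min ltW//=; move: ht; rewrite ltr_norml => /andP[]; lra.
  have ah : 0 < `|h| by rewrite normr_gt0.
  have inc s h' : 0 <= s -> 0 < h' -> h' < r ->
      `|J (s + h') - J s - h' * j s| <= h' * (e / 2).
    move=> s0 h'0 h'r; have h'0' := ltW h'0; rewrite /J /j !max_l ?addr_ge0//.
    apply: le_trans (orbit_increment s0 h'0) _; rewrite ler_pM2l//.
    have /ltW h1 : L2nrm m (fun x => h'^-1 * (P h' u x - u x) - v x) < e / 2 / (L2nrm m g + 1).
      have := rQ h'; rewrite /ball_ /= !sub0r !normrN gtr0_norm// => /(_ h'r h'0).
      by rewrite ger0_norm// L2nrm_ge0.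
    apply: (@le_trans _ _ (e / 2 / (L2nrm m g + 1) * (L2nrm m g + 1))).
      by apply: ler_pM => //; rewrite ?L2nrm_ge0// lerDl.
    by rewrite divfK// gt_eqF// ltr_wpDl// L2nrm_ge0.
  have Jinc : `|J (h + t) - J t - h * j a| <= `|h| * (e / 2).
    have [h'0|h'0] := ltP 0 h.
      rewrite /a min_l; last by rewrite lerDl ltW.
      by rewrite (gtr0_norm h'0) [h + t]addrC; apply: inc; rewrite ?ltW// -(gtr0_norm h'0).
    have aE : a = t + h by rewrite /a min_r// gerDl.
    have := inc a `|h| a0 ah hr; rewrite (ler0_norm h'0) aE addrK [h + t]addrC.
    by rewrite -normrN; congr (`|_| <= _); ring.
  rewrite distrC.
  have -> : h^-1 *: (J (h *: (1 : R) + t) - J t) - j t =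
      h^-1 * (J (h + t) - J t - h * j a) + (j a - j t).
    rewrite /GRing.scale /= mulr1; field.
    exact: h0.
  apply: le_lt_trans (ler_normD _ _) _.
  have h1 : `|h^-1 * (J (h + t) - J t - h * j a)| <= e / 2.
    by rewrite normrM normfV ler_pdivrMl.
  have h2 : `|j a - j t| < e / 2.
    rewrite distrC; apply: qj; rewrite /ball /=; apply: le_lt_trans hq.
    have := ler_norm h; have := ler_norm (- h); rewrite normrN.
    by rewrite /a ler_norml /Num.min; case: ltP => *; apply/andP; split; lra.
  lra.
apply: DeriveDef; first by apply/cvg_ex; exists (j t).
exact/cvg_lim.
Qed.

End contraction_semigroup_theory.

Section exponential_weight.
Context {R : realType}.
Notation leb := (@lebesgue_measure R).

Lemma continuous_expRN (lam : R) : continuous (fun t : R => expR (- (lam * t))).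
Proof.
move=> t; apply: (@cvg_comp _ _ _ (fun t => - (lam * t)) expR); last exact: continuous_expR.
by apply: cvgN; apply: cvgM; [exact: cvg_cst|exact: cvg_id].
Qed.

(** Up to the factor lam this is the density of the exponential law. *)
Lemma integrable_expRN (lam : R) : 0 < lam ->
  leb.-integrable `[0, +oo[ (EFin \o (fun t => expR (- (lam * t)))).
Proof.
move=> lam0.
have mI : measurable (`[0, +oo[%classic : set (measurableTypeR R)) by exact: measurable_itv.
have := integrableS measurableT mI (@subsetT _ _) (integrable_exponential_pdf lam0).
move=> /(integrableZl mI lam^-1); apply: eq_integrable => // t.
rewrite inE /= in_itv/= andbT => t0; rewrite exponential_pdfE// -EFinM.
by rewrite mulrA mulVf ?gt_eqF// mul1r mulNr.
Qed.

End exponential_weight.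

(** * The resolvent of the generator as a weak Laplace transform *)

Section laplace.
Context {R : realType} {d : measure_display} {E : measurableType d}.
Variable m : {measure set E -> \bar R}.
Variable P : R -> (E -> R) -> E -> R.
Hypotheses (sP : contraction_semigroup m P) (cP : strongly_continuous m P).
Notation leb := (@lebesgue_measure R).

(** The generator sends u to v = lam u - f, so -e^{-lam t} <P(t) u, g> has derivative e^{-lam t}
    <P(t)(lam u - v), g> = e^{-lam t} <P(t) f, g>. Integrating from 0 to infinity leaves the value
    <u, g> at 0. *)
Lemma semigroup_laplace (lam : R) (u f g : E -> R) : 0 < lam ->
  generator m P u (fun x => lam * u x - f x) -> L2 m f -> L2 m g ->
  let F t := expR (- (lam * t)) * L2dot m (P t f) g in
  leb.-integrable `[0, +oo[ (EFin \o F) /\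
  \int[leb]_(t in `[0, +oo[) F t = L2dot m u g.
Proof.
move=> lam0 guv lf lg F; set v := (fun x => lam * u x - f x) in guv.
have [lu lv _] := guv.
have lP t h : 0 <= t -> L2 m h -> L2 m (P t h) by move=> t0; exact: semigroup_L2.
have mI : measurable (`[0, +oo[%classic : set (measurableTypeR R)) by exact: measurable_itv.
have max0 (s : R) : 0 <= Num.max s 0 by rewrite le_max lexx orbT.
pose J (s : R) := L2dot m (P (Num.max s 0) u) g.
pose j (s : R) := L2dot m (P (Num.max s 0) v) g.
pose e (s : R) := expR (- (lam * s)).
pose k (s : R) := e s * L2dot m (P (Num.max s 0) f) g.
pose G (s : R) := - (e s * J s).
have L2dot_bound s h : L2 m h -> `|L2dot m (P (Num.max s 0) h) g| <= L2nrm m h * L2nrm m g.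
  move=> lh; apply: le_trans (L2dot_le (lP _ _ (max0 s) lh) lg) _.
  by rewrite ler_wpM2r ?L2nrm_ge0// semigroup_L2nrm.
have kE s : k s = e s * (lam * J s - j s).
  congr (_ * _); rewrite /J /j.
  have llu : L2 m (fun x => lam * u x) by exact: L2Z.
  have lPs h : L2 m h -> L2 m (P (Num.max s 0) h) by exact: lP.
  have -> : L2dot m (P (Num.max s 0) f) g =
      L2dot m (fun x => lam * P (Num.max s 0) u x - P (Num.max s 0) v x) g.
    apply: L2dot_ae_eq => //; first exact: lPs.
      by apply: L2B; [apply: L2Z|]; exact: lPs.
    have := semigroupZ sP lam (max0 s) lu.
    have := semigroupB sP (max0 s) llu lv.
    rewrite (_ : (fun y => lam * u y - v y) = f); last by apply/funext => y; rewrite /v; ring.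
    by apply: filterS2 => x -> ->.
  by rewrite L2dotBl ?L2dotZl//; [exact: lPs|apply: L2Z; exact: lPs|exact: lPs].
have ce : continuous e by exact: continuous_expRN.
have cJ : continuous J by exact: (orbit_continuous sP cP lg lu).
have ck : continuous k.
  move=> s; apply: cvgM; first exact: ce.
  exact: (orbit_continuous sP cP lg lf).
have cG : continuous G by move=> s; apply: cvgN; apply: cvgM; [exact: ce|exact: cJ].
(* Only for s > 0: at 0 the truncation [Num.max s 0] freezes the orbit on the left. *)
have dG (s : R) : 0 < s -> is_derive s (1 : R) G (k s).
  move=> s0; have dJ := orbit_derive sP cP guv lg s0.
  have de : is_derive s (1 : R) e (- lam * e s).
    by rewrite /e; apply: is_derive_eq; rewrite /GRing.scale /=; ring.
  rewrite /G; apply: is_derive_eq.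

  by rewrite kE /GRing.scale /= /J /j; ring.
have FTC b : 0 < b -> (\int[leb]_(x in `[0%R, b]) (k x)%:E = (G b)%:E - (G 0)%:E)%E.
  move=> b0; apply: continuous_FTC2 => //.
  - exact: continuous_subspaceT.
  - split.
    + by move=> s; rewrite in_itv/= => /andP[s0 _]; exact: (@ex_derive _ _ _ _ _ _ _ (dG s s0)).
    + by apply/cvg_at_right_filter; exact: cG.
    + by apply/cvg_at_left_filter; exact: cG.
  - move=> s; rewrite in_itv/= => /andP[s0 _]; rewrite derive1E.
    exact: (@derive_val _ _ _ _ _ _ _ (dG s s0)).
have ik : leb.-integrable `[0, +oo[ (EFin \o k).
  apply: (le_integrable mI _ _ (integrableZl mI (L2nrm m f * L2nrm m g) (integrable_expRN lam0))).
    by apply/measurable_EFinP; apply: measurable_funTS; exact: continuous_measurable_fun.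
  move=> s _; rewrite /= lee_fin [leRHS]ger0_norm; last first.
    by rewrite !mulr_ge0 ?L2nrm_ge0 ?expR_ge0.
  by rewrite [leRHS]mulrC normrM ger0_norm ?expR_ge0// ler_wpM2l ?expR_ge0// L2dot_bound.
have G0 : G n.+1%:R @[n --> \oo] --> 0.
  apply/cvgr0Pnorm_lt => r r0.
  have h : e n.+1%:R * (L2nrm m u * L2nrm m g) @[n --> \oo] --> 0 * (L2nrm m u * L2nrm m g).
    apply: cvgM; last exact: cvg_cst.
    (* With eps n = 1 / (n + 1) and z = lam the penalty factor is e^{-lam (n + 1)}. *)
    have := cvg_expR_penalty (eps := harmonic) harmonic_gt0 cvg_harmonic (ltW lam0).
    rewrite gt_eqF//; apply: cvg_trans; apply: near_eq_cvg; apply: nearW => n /=.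
    by rewrite /e invrK mulrC.
  move: h; rewrite mul0r => /cvgr0Pnorm_lt /(_ _ r0); apply: filterS => n.
  apply: le_lt_trans; rewrite /G normrN !normrM.
  by rewrite ler_wpM2l// (ger0_norm (L2nrm_ge0 _ _)) (ger0_norm (L2nrm_ge0 _ _)) L2dot_bound.
have JE : J 0 = L2dot m u g.
  by rewrite /J maxxx; apply: L2dot_ae_eq => //; [exact: lP|exact: semigroup_0].
have [] := @dominated_convergence _ _ _ leb `[0, +oo[%classic mI
   (fun n s => (k s * \1_(`[0, n.+1%:R]%classic : set R) s)%:E) (EFin \o k) (fun s => `|(k s)%:E|%E).
- move=> n; apply/measurable_EFinP; apply: measurable_funTS; apply: measurable_funM.
    exact: continuous_measurable_fun.
  by apply: measurable_indic; exact: measurable_itv.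
- exact: measurable_int ik.
- apply: aeW => s; rewrite /= in_itv/= andbT => s0; apply/cvg_EFin; first exact: nearW.
  apply: (@cvg_trans _ (cst (k s) @ \oo)); last exact: cvg_cst.
  apply: near_eq_cvg; near=> n => /=.
  rewrite indicE mem_set ?mulr1// /= in_itv/= s0/=.
  apply: (@le_trans _ _ n%:R); last by rewrite ler_nat.
  near: n; exact: nbhs_infty_ger.
- exact: integrable_abse.
- apply: aeW => s n _ /=; rewrite lee_fin normrM ler_piMr// indicE.
  by case: (_ \in _); rewrite ?normr1 ?normr0.
move=> _ _ kc.
have E1 n : (\int[leb]_(s in `[0%R, +oo[) (k s * \1_(`[0%R, n.+1%:R]%classic : set R) s)%:E =
    (G n.+1%:R - G 0)%:E)%E.
  rewrite EFinB -FTC// [RHS](_ : _ = \int[leb]_(x in `[0%R, +oo[ `&` `[0%R, n.+1%:R]) (k x)%:E)%E.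
    rewrite integral_mkcondr; apply: eq_integral => s _; rewrite patchE indicE.
    by case: (s \in _); rewrite ?mulr1 ?mulr0.
  by congr (integral _ _ _); rewrite setIidr//; exact: subset_itvl.

have FE : \int[leb]_(t in `[0, +oo[) F t = \int[leb]_(t in `[0, +oo[) k t.
  by apply: eq_Rintegral => s; rewrite inE /= in_itv/= andbT => s0; rewrite /k /F max_l.
split.
  apply: eq_integrable ik => // s; rewrite inE /= in_itv/= andbT => s0.
  by rewrite /k /F max_l.
rewrite FE -JE.
have h1 : G n.+1%:R - G 0 @[n --> \oo] --> \int[leb]_(t in `[0, +oo[) k t.
  move: kc; rewrite -(fineK (integrable_fin_num mI ik)) => /fine_cvg.
  by apply: cvg_trans; apply: near_eq_cvg; apply: nearW => n /=; rewrite E1.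
have h2 : G n.+1%:R - G 0 @[n --> \oo] --> 0 - G 0.
  by apply: cvgB => //; exact: cvg_cst.
rewrite (cvg_unique _ h1 h2)// sub0r /G opprK /e mulr0 oppr0 expR0 mul1r//.
Unshelve. all: by end_near. Qed.

End laplace.

(** * Restriction to a closed set *)

Section restricted_measure.
Context {R : realType} {H : completeNormedModType R}.
Variables (mu : probability (borel H) R) (K : set H) (cK : closed K).
Notation mK := (muK mu cK).
Implicit Types f g : borel H -> R.

Let mKset : measurable (K : set (borel H)) := closed_borel cK.

Lemma muKE (A : set (borel H)) : mK A = mu (A `&` K).
Proof. by []. Qed.

Lemma muKC : mK (~` K) = 0%E.
Proof. by rewrite muKE setICl measure0. Qed.

Lemma ae_muK (P : borel H -> Prop) : {ae mu, forall x, P x} -> {ae mK, forall x, P x}.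
Proof.
move=> [N [mN N0 PN]]; exists N; split => //; apply/eqP.
rewrite eq_le measure_ge0 andbT muKE -N0.
by apply: le_measure; rewrite ?inE//; exact: measurableI.
Qed.

Lemma ae_muK_in (P : borel H -> Prop) : (forall x, K x -> P x) -> {ae mK, forall x, P x}.
Proof.
move=> KP; exists (~` K); split => //; [exact: measurableC|exact: muKC|].
by apply: subsetC.
Qed.

Lemma integral_muK_in (f : borel H -> \bar R) :
  (\int[mK]_(x in K) f x = \int[mu]_(x in K) f x)%E.
Proof. by apply: eq_measure_integral => A mA AK; rewrite /= muKE setIidl. Qed.

Lemma ge0_integral_muK (f : borel H -> \bar R) : measurable_fun setT f ->
  (forall x, (0 <= f x)%E) -> (\int[mK]_x f x = \int[mu]_(x in K) f x)%E.
Proof.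
move=> mf f0; rewrite (@ge0_negligible_integral _ _ _ mK _ (~` K))//; last 2 first.
- exact: measurableC.
- exact: muKC.
by rewrite setTD setCK integral_muK_in.
Qed.

Lemma zero_extE f : zero_ext K f = f \_ K.
Proof. by apply/funext => x; rewrite /zero_ext patchE. Qed.

Lemma ae_zero_ext f : {ae mK, forall x, zero_ext K f x = f x}.
Proof. by apply: ae_muK_in => x Kx; rewrite /zero_ext mem_set. Qed.

Lemma L2norm_muK_le f : measurable_fun setT f -> (L2norm mK f <= L2norm mu f)%E.
Proof.
move=> mf; rewrite /L2norm unlock gt0_ler_poweR//.
- by rewrite in_itv/= leey integral_ge0// => x _; rewrite poweR_ge0.
- by rewrite in_itv/= leey integral_ge0// => x _; rewrite poweR_ge0.
have mp : measurable_fun setT (fun x => (`|f x| `^ 2)%:E).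
  apply/measurable_EFinP/(@measurableT_comp _ _ _ _ _ _ (@powR R ^~ 2)) => //.
  exact: measurableT_comp.
by rewrite ge0_integral_muK//=; apply: ge0_subset_integral.
Qed.

Lemma L2_muK f : L2 mu f -> L2 mK f.
Proof.
move=> lf; have mf := L2_measurable lf; apply: L2_of_lty => //.
exact: le_lt_trans (L2norm_muK_le mf) (L2_lty lf).
Qed.

Lemma L2nrm_muK_le f : L2 mu f -> L2nrm mK f <= L2nrm mu f.
Proof.
move=> lf; rewrite -lee_fin -!L2nrmE//; last exact: L2_muK.
by apply: L2norm_muK_le; exact: L2_measurable lf.
Qed.

Lemma measurable_zero_ext f : measurable_fun setT f ->
  measurable_fun setT (zero_ext K f : borel H -> R).
Proof.
move=> mf; rewrite zero_extE; apply/measurable_restrict => //.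
exact: measurable_funTS.
Qed.

Lemma L2norm_zero_ext f : measurable_fun setT f ->
  L2norm mu (zero_ext K f) = L2norm mK f.
Proof.
move=> mf; rewrite /L2norm unlock; congr poweR.
have mp : measurable_fun setT (fun x => (`|f x| `^ 2)%:E).
  apply/measurable_EFinP/(@measurableT_comp _ _ _ _ _ _ (@powR R ^~ 2)) => //.
  exact: measurableT_comp.
rewrite ge0_integral_muK//= [RHS]integral_mkcond; apply: eq_integral => x _.
rewrite /zero_ext patchE; case: ifP => //= _.
by rewrite normr0 powR0.
Qed.

Lemma L2_zero_ext f : L2 mK f -> L2 mu (zero_ext K f).
Proof.
move=> lf; have mf := L2_measurable lf; apply: L2_of_lty; first exact: measurable_zero_ext.
by rewrite L2norm_zero_ext// L2_lty.
Qed.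

Lemma L2nrm_zero_ext f : L2 mK f -> L2nrm mu (zero_ext K f) = L2nrm mK f.
Proof. by move=> lf; rewrite /L2nrm L2norm_zero_ext//; exact: L2_measurable lf. Qed.

(** Extension by zero is the adjoint of restriction to K. It lifts a test function on K to H, where
    the Laplace formula for P^eps holds. *)
Lemma L2dot_zero_ext f g : L2 mu f -> L2 mK g ->
  L2dot mu f (zero_ext K g) = L2dot mK f g.
Proof.
move=> lf lg; rewrite /L2dot /Rintegral; congr fine.
have ifg := L2dot_integrable (L2_muK lf) lg.
rewrite [RHS](negligible_integral _ _ ifg muKC)//; last exact: measurableC.
rewrite setTD setCK integral_muK_in [RHS]integral_mkcond; apply: eq_integral => x _.
by rewrite /zero_ext patchE /=; case: ifP => //= _; rewrite mulr0.
Qed.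

End restricted_measure.

(** The positive and negative parts each have an integral in [0, M], so their difference has
    absolute value at most M. No measurability of f enters, which suits the Feynman-Kac
    integrand. *)
Lemma Rintegral_bound {R : realType} {d : measure_display} {T : measurableType d}
    (m : probability T R) (f : T -> R) (M : R) : 0 <= M ->
  (forall x, `|f x| <= M) -> `|\int[m]_x f x| <= M.
Proof.
move=> M0 fM; rewrite /Rintegral integralE.
have le (h : T -> \bar R) : (forall x, (0 <= h x)%E) -> (forall x, (h x <= M%:E)%E) ->
    exists2 r, (\int[m]_x h x = r%:E)%E & 0 <= r <= M.
  move=> h0 hM; have i0 : (0 <= \int[m]_x h x)%E by exact: integral_ge0.
  have iM : (\int[m]_x h x <= M%:E)%E.
    have -> : (M%:E = \int[m]_x cst M%:E x)%E.
      by rewrite integral_cst// [X in (_ * X)%E]probability_setT mule1.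
    by apply: (ge0_le_integral_off_null (N := set0)).
  move: i0 iM; case: (\int[m]_x h x)%E => //= r; rewrite !lee_fin => r0 rM.
  by exists r => //; rewrite r0.
have [||p -> /andP[p0 pM]] := le (fun x => (EFin \o f)^\+ x)%E.
- by [].
- move=> x; rewrite funeposE ge_max !lee_fin M0 andbT.
  exact: le_trans (ler_norm _) (fM x).
have [||q -> /andP[q0 qM]] := le (fun x => (EFin \o f)^\- x)%E.
- by [].
- move=> x; rewrite funenegE ge_max !lee_fin M0 andbT.
  by apply: le_trans (fM x); rewrite -normrN ler_norm.
by rewrite /= ler_norml; apply/andP; split; lra.
Qed.

(** * Convergence of the penalized semigroups *)

Section penalization_limit.
Context {R : realType} {H : completeNormedModType R}.
Context {d : measure_display} {Omega : measurableType d}.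
Variables (Pr : probability Omega R) (X : R -> H -> Omega -> H).
Hypothesis mX : forall x (t : R) (B : set (borel H)), 0 <= t -> measurable B ->
  measurable (X t x @^-1` B).
Hypothesis cX : forall x,
  {ae Pr, forall w, {within `[0, +oo[, continuous (fun t => X t x w)}}.
Variables (mu : probability (borel H) R) (K : set H) (cK : closed K).
Variable V : H -> R.
Hypotheses (cV : continuous V) (bV : bounded_fun V).
Hypotheses (V0 : forall y, K y -> V y = 0) (Vgt0 : forall y, (~` K) y -> 0 < V y).
Variable P : R -> R -> (borel H -> R) -> borel H -> R.
Hypothesis HP : forall eps, 0 < eps -> penalized_semigroup Pr X mu V eps (P eps).
Variable T : R -> (borel H -> R) -> borel H -> R.
Hypothesis HT : killed_semigroup Pr X mu cK T.
Notation mK := (muK mu cK).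
Notation leb := (@lebesgue_measure R).

Lemma feynman_kac_bound (phi : H -> R) (M eps t : R) x : 0 < eps ->
  (forall y, `|phi y| <= M) -> `|feynman_kac Pr X V eps t phi x| <= M.
Proof.
move=> e0 phiM; have M0 : 0 <= M by apply: le_trans (phiM x).
apply: Rintegral_bound => // w; rewrite normrM -[leRHS]mulr1 ler_pM//.
rewrite ger0_norm ?expR_ge0// -expR0 ler_expR oppr_le0 mulr_ge0//.
  by rewrite invr_ge0 ltW.
apply: Rintegral_ge0 => s _.
by have [/V0 ->//|/Vgt0 /ltW] := pselect (K (X s x w)).
Qed.

Lemma killed_expectation_bound (phi : H -> R) (M t : R) x :
  (forall y, `|phi y| <= M) -> `|killed_expectation Pr X K t phi x| <= M.
Proof.
move=> phiM; have M0 : 0 <= M by apply: le_trans (phiM x).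
apply: Rintegral_bound => // w; rewrite normrM -[leRHS]mulr1 ler_pM//.
by rewrite indicE; case: (_ \in _); rewrite ?normr1 ?normr0.
Qed.

Let PL2 eps t f : 0 < eps -> 0 <= t -> L2 mu f -> L2 mu (P eps t f).
Proof. by move=> e0 t0; apply: semigroup_L2 => //; exact: penalized_contraction (HP e0). Qed.

Let TL2 t f : 0 <= t -> L2 mK f -> L2 mK (T t f).
Proof. by move=> t0; apply: semigroup_L2 => //; exact: killed_contraction HT. Qed.

Section sequence.
Variable eps : nat -> R.
Hypotheses (e0 : forall n, 0 < eps n) (ec : eps n @[n --> \oo] --> 0).

Lemma penalized_cvg_Cb (t : R) (phi : H -> R) : 0 < t ->
  continuous phi -> bounded_fun phi ->
  L2nrm mK (fun x => P (eps n) t phi x - T t phi x) @[n --> \oo] --> 0.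
Proof.
move=> t0 cphi bphi; have t0' := ltW t0.
have lphi := L2_Cb mu cphi bphi.
have [M phiM] : exists M, forall y, `|phi y| <= M.
  have [M [_ /(_ (M + 1) (ltr_pwDr ltr01 (lexx M))) h]] := bphi.
  by exists (M + 1) => y; exact: h.
(* One exceptional null set for each n: their union is null because the parameter runs through a
   sequence. *)
have aeP : {ae mK, forall x n, P (eps n) t phi x = feynman_kac Pr X V (eps n) t phi x}.
  by apply: ae_muK; apply/ae_foralln => n; exact: (penalized_extends (HP (e0 n)) t0' cphi bphi).
have aeT : {ae mK, forall x, T t phi x = killed_expectation Pr X K t phi x}.
  by apply: (killed_extends HT) => //; exact: continuous_borel.
apply: (@L2nrm_dominated_cvg0 _ _ _ mK _ (cst (M + M))).
- move=> n; apply: measurable_funB.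
    exact: L2_measurable (PL2 (e0 n) t0' lphi).
  exact: L2_measurable (TL2 t0' (L2_muK cK lphi)).
- exact/L2_muK/L2_cst.
- apply: filterS2 aeP aeT => x Px -> n; rewrite Px; apply: le_trans (ler_normB _ _) _.
  by rewrite lerD// ?feynman_kac_bound// killed_expectation_bound.
apply: filterS2 aeP aeT => x Px ->; under eq_fun do rewrite Px.
have FK : feynman_kac Pr X V (eps n) t phi x @[n --> \oo] -->
    killed_expectation Pr X K t phi x by exact: (feynman_kac_cvg (mX x) (cX x)).
have := cvgB FK (cvg_cst (killed_expectation Pr X K t phi x)).
by rewrite subrr; exact.
Qed.

Lemma penalized_cvg (t : R) (f : borel H -> R) : 0 <= t -> L2 mK f ->
  L2nrm mK (fun x => P (eps n) t (zero_ext K f) x - T t f x) @[n --> \oo] --> 0.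
Proof.
move=> + lf; have lf' := L2_zero_ext lf.
have lPf n s : 0 <= s -> L2 mK (P (eps n) s (zero_ext K f)).
  by move=> s0; exact/L2_muK/PL2.
(* Time 0 belongs to the half-line of the Laplace integrals; there both semigroups return f almost
   everywhere on K. *)
rewrite le_eqVlt => /predU1P[<-|t0].
  rewrite (_ : (fun _ => _) = cst 0); first exact: cvg_cst.
  apply/funext => n; transitivity (L2nrm mK (fun x => 0 * f x)); last first.
    by rewrite L2nrmZ// normr0 mul0r.
  apply: L2nrm_ae_eq; [by apply: L2B; [exact: lPf|exact: TL2]|exact: L2Z|].
  have h1 := ae_muK cK (semigroup_0 (penalized_contraction (HP (e0 n))) lf').
  have h2 := semigroup_0 (killed_contraction HT) lf.
  by apply: filterS3 h1 h2 (ae_zero_ext mu cK f) => x -> -> ->; rewrite subrr mul0r.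
have t0' := ltW t0.
(* A function phi close to f~ in L^2(mu) is as close to f in L^2(K, mu). Contractivity of each
   semigroup accounts for one third of e, and the C_b case for the remaining one. *)
apply/cvgr0Pnorm_lt => e e_gt0; have e3 : 0 < e / 3 by rewrite divr_gt0.
have [phi [cphi bphi] fphi] := (Cb_dense lf').2 _ e3.
have lphi := L2_Cb mu cphi bphi.
have /cvgr0Pnorm_lt /(_ _ e3) := penalized_cvg_Cb t0 cphi bphi.
apply: filterS => n; rewrite !ger0_norm ?L2nrm_ge0// => hn.
have lPphi := L2_muK cK (PL2 (e0 n) t0' lphi).
have lTf := TL2 t0' lf; have lTphi := TL2 t0' (L2_muK cK lphi).
have lPf' := lPf n t t0'.
have h1 : L2nrm mK (fun x => P (eps n) t (zero_ext K f) x - P (eps n) t phi x) < e / 3.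
  apply: le_lt_trans fphi.
  apply: (le_trans (L2nrm_muK_le _ (L2B (PL2 (e0 n) t0' lf') (PL2 (e0 n) t0' lphi)))).
  exact: (semigroup_dist (penalized_contraction (HP (e0 n))) t0' lf' lphi).
have h3 : L2nrm mK (fun x => T t phi x - T t f x) < e / 3.
  apply: le_lt_trans (semigroup_dist (killed_contraction HT) t0' (L2_muK cK lphi) lf) _.
  apply: le_lt_trans fphi; rewrite (L2nrmC (L2_muK cK lphi) lf).
  apply: le_trans (L2nrm_muK_le cK (L2B lf' lphi)).
  rewrite le_eqVlt; apply/orP; left; apply/eqP; apply: L2nrm_ae_eq.
  - by apply: L2B => //; exact: L2_muK.
  - by apply/L2_muK/L2B.
  - by apply: (@filterS (borel H) (almost_everywhere mK) _ _ _ _ (ae_zero_ext mu cK f)) => x ->.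
have := L2nrm_triangle lPf' lTf lPphi; have := L2nrm_triangle lPphi lTf lTphi.
lra.
Qed.

Lemma penalized_gap_continuous (n k : nat) (f : borel H -> R) : L2 mu f ->
  continuous (fun s : R =>
    L2nrm mK (fun x => P (eps n) (Num.max s 0) f x - P (eps k) (Num.max s 0) f x)).
Proof.
move=> lf t; have max0 (s : R) : 0 <= Num.max s 0 by rewrite le_max lexx orbT.
have sc i := semigroup_cvg (penalized_contraction (HP (e0 i)))
  (penalized_continuous (HP (e0 i))) t lf.
have lPmu i (s : R) : L2 mu (P (eps i) (Num.max s 0) f) by exact: PL2.
have lPK i (s : R) : L2 mK (P (eps i) (Num.max s 0) f) by exact: L2_muK.
apply/cvgrPdist_lt => e e_gt0; have e2 : 0 < e / 2 by rewrite divr_gt0.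
have /cvgr0Pnorm_lt /(_ _ e2) hn := sc n; have /cvgr0Pnorm_lt /(_ _ e2) hk := sc k.
apply: filterS2 hn hk => s; rewrite !(ger0_norm (L2nrm_ge0 _ _)) => hn hk.
have dK i : L2nrm mK (fun x => P (eps i) (Num.max t 0) f x - P (eps i) (Num.max s 0) f x) <=
    L2nrm mu (fun x => P (eps i) (Num.max s 0) f x - P (eps i) (Num.max t 0) f x).
  by rewrite (L2nrmC (lPK i t) (lPK i s)); apply/L2nrm_muK_le/L2B.
have := L2nrm_dist (lPK n t) (lPK n s) (lPK k t).
have := L2nrm_dist (lPK k t) (lPK k s) (lPK n s).
rewrite (L2nrmC (lPK k t) (lPK n s)) (L2nrmC (lPK k s) (lPK n s)) => h1 h2.
(* The intermediate term has the first orbit at time s and the second at time t, so that each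
   comparison moves a single orbit. *)
apply: le_lt_trans (ler_distD (L2nrm mK (fun x => P (eps n) (Num.max s 0) f x -
  P (eps k) (Num.max t 0) f x)) _ _) _.
have := dK n; have := dK k; lra.
Qed.

(* The gap is the limit, as k tends to infinity, of the distances between the
   orbits of [P (eps n)] and [P (eps k)], which are continuous in time, whereas
   the killed semigroup is only weakly measurable. *)
Lemma penalized_gap_measurable (n : nat) (f : borel H -> R) : L2 mK f ->
  measurable_fun (`[0, +oo[%classic : set (measurableTypeR R))
    (fun t : R => L2nrm mK (fun x => P (eps n) t (zero_ext K f) x - T t f x)).
Proof.
move=> lf; have lf' := L2_zero_ext lf.
apply: (@measurable_fun_cvg _ (measurableTypeR R) R _ (fun k s =>
    L2nrm mK (fun x => P (eps n) (Num.max s 0) (zero_ext K f) x -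
                    P (eps k) (Num.max s 0) (zero_ext K f) x))).
  move=> k; apply: measurable_funTS; apply: continuous_measurable_fun.
  exact: penalized_gap_continuous.
move=> t; rewrite /= in_itv/= andbT => t0; rewrite max_l//.
have lPK i : L2 mK (P (eps i) t (zero_ext K f)) by exact/L2_muK/PL2.
have lT := TL2 t0 lf.
apply/cvgrPdist_lt => e e_gt0.
have /cvgr0Pnorm_lt /(_ _ e_gt0) := penalized_cvg t0 lf.
apply: filterS => k; rewrite (ger0_norm (L2nrm_ge0 _ _)); apply: le_lt_trans.
rewrite (L2nrmC (lPK n) lT) (L2nrmC (lPK n) (lPK k)) distrC.
exact: L2nrm_dist.
Qed.

(** Here [u] stands for R(lam, M^eps) f~, known through the generator equation, and [r] for R(lam,
    L) f, known through its weak Laplace formula. *)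
Lemma resolvent_gap (lam : R) (n : nat) (u r f : borel H -> R) : 0 < lam ->
  L2 mK f -> generator mu (P (eps n)) u (fun x => lam * u x - zero_ext K f x) ->
  L2 mK r ->
  (forall g, L2 mK g ->
    let F t := expR (- (lam * t)) * \int[mK]_x (T t f x * g x) in
    leb.-integrable `[0, +oo[ (EFin \o F) /\
    \int[leb]_(t in `[0, +oo[) F t = \int[mK]_x (r x * g x)) ->
  leb.-integrable `[0, +oo[ (EFin \o (fun t : R => expR (- (lam * t)) *
    L2nrm mK (fun x => P (eps n) t (zero_ext K f) x - T t f x))) ->
  L2nrm mK (fun x => u x - r x) <= \int[leb]_(t in `[0, +oo[) (expR (- (lam * t)) *
    L2nrm mK (fun x => P (eps n) t (zero_ext K f) x - T t f x)).
Proof.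
move=> lam0 lf gu lr hr iN; have lf' := L2_zero_ext lf.
have [lu _ _] := gu; set g := (fun x => u x - r x).
have lg : L2 mK g by apply: L2B => //; exact: L2_muK.
have [iT eT] : leb.-integrable `[0, +oo[
      (EFin \o (fun t => expR (- (lam * t)) * L2dot mK (T t f) g)) /\
    \int[leb]_(t in `[0, +oo[) (expR (- (lam * t)) * L2dot mK (T t f) g) = L2dot mK r g.
  exact: hr.
have [iP eP] := semigroup_laplace (penalized_contraction (HP (e0 n)))
  (penalized_continuous (HP (e0 n))) lam0 gu lf' (L2_zero_ext lg).
have mI : measurable (`[0, +oo[%classic : set (measurableTypeR R)) by exact: measurable_itv.
rewrite L2dot_zero_ext// in eP.
(* The main estimate bounds |g|^2 by |g| times the integral, so a positive |g| is needed to cancel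
   it. *)
have [->|g0] := eqVneq (L2nrm mK g) 0.
  by apply: Rintegral_ge0 => t _; rewrite mulr_ge0 ?expR_ge0 ?L2nrm_ge0.
have {}g0 : 0 < L2nrm mK g by rewrite lt_neqAle eq_sym g0 L2nrm_ge0.
rewrite -(ler_pM2r g0) -expr2 -L2dot_sqr// {1}/g L2dotBl//; last exact: L2_muK.
rewrite -eP -eT -RintegralB// -RintegralZr//.
apply: le_Rintegral => //.
- by have := integrableB mI iP iT; apply: eq_integrable.
- exact: (integrableZr mI (L2nrm mK g) iN).
move=> t; rewrite /= in_itv/= andbT => t0.
have lPt : L2 mu (P (eps n) t (zero_ext K f)) by exact: PL2.
rewrite L2dot_zero_ext// -mulrBr -mulrA ler_wpM2l ?expR_ge0//.
apply: le_trans (ler_norm _) _.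
by apply: L2dot_dist => //; [exact: L2_muK|exact: TL2].
Qed.

Lemma resolvent_cvg (lam : R) (u : nat -> borel H -> R) (r f : borel H -> R) : 0 < lam ->
  L2 mK f ->
  (forall n, generator mu (P (eps n)) (u n) (fun x => lam * u n x - zero_ext K f x)) ->
  L2 mK r ->
  (forall g, L2 mK g ->
    let F t := expR (- (lam * t)) * \int[mK]_x (T t f x * g x) in
    leb.-integrable `[0, +oo[ (EFin \o F) /\
    \int[leb]_(t in `[0, +oo[) F t = \int[mK]_x (r x * g x)) ->
  L2nrm mK (fun x => u n x - r x) @[n --> \oo] --> 0.
Proof.
move=> lam0 lf gu lr hr; have lf' := L2_zero_ext lf.
have mI : measurable (`[0, +oo[%classic : set (measurableTypeR R)) by exact: measurable_itv.
pose N n t := L2nrm mK (fun x => P (eps n) t (zero_ext K f) x - T t f x).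
pose w n (t : R) := expR (- (lam * t)) * N n t.
have N_ge0 n t : 0 <= N n t by exact: L2nrm_ge0.
have w_ge0 n t : 0 <= w n t by rewrite mulr_ge0 ?expR_ge0.
have NM n t : 0 <= t -> N n t <= L2nrm mK f + L2nrm mK f.
  move=> t0; have lPt := PL2 (e0 n) t0 lf'; have lTt := TL2 t0 lf.
  have := L2nrmD (L2_muK cK lPt) (L2Z (-1) lTt); rewrite L2nrmZ// normrN1 mul1r.
  rewrite (_ : (fun _ => _) = (fun x => P (eps n) t (zero_ext K f) x - T t f x)); last first.
    by apply/funext => x; rewrite mulN1r.
  move=> h; apply: le_trans h _; rewrite lerD//.
    apply: le_trans (L2nrm_muK_le cK lPt) _; rewrite -(L2nrm_zero_ext lf).
    exact: (semigroup_L2nrm (penalized_contraction (HP (e0 n)))).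
  exact: (semigroup_L2nrm (killed_contraction HT)).
have mw n : measurable_fun (`[0, +oo[%classic : set (measurableTypeR R)) (w n).
  apply: measurable_funM; last exact: penalized_gap_measurable.
  by apply: measurable_funTS; apply: continuous_measurable_fun; exact: continuous_expRN.
(* Both orbits stay in the ball of radius |f|, whence the majorant 2 |f| e^{-lam t}, integrable and
   independent of n. *)
pose C := L2nrm mK f + L2nrm mK f.
have iC := integrableZl mI C (integrable_expRN lam0).
have wC n t : 0 <= t -> w n t <= C * expR (- (lam * t)).
  by move=> t0; rewrite /w mulrC ler_wpM2r ?expR_ge0// NM.
have iw n : leb.-integrable `[0, +oo[ (EFin \o w n).
  apply: (le_integrable mI _ _ iC); first exact/measurable_EFinP.
  move=> t; rewrite /= in_itv/= andbT => t0; rewrite lee_fin ger0_norm//.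
  by apply: le_trans (ler_norm _); exact: wC.
have w0 : \int[leb]_(t in `[0, +oo[) w n t @[n --> \oo] --> 0.
  have [] := @dominated_convergence _ _ _ leb `[0, +oo[%classic mI
    (fun n t => (w n t)%:E) (cst 0%E) (fun t => (C%:E * (expR (- (lam * t)))%:E)%E).
  - by move=> n; apply/measurable_EFinP.
  - exact: measurable_cst.
  - apply: aeW => t; rewrite /= in_itv/= andbT => t0; apply/cvg_EFin; first exact: nearW.
    have := cvgM (cvg_cst (expR (- (lam * t)))) (penalized_cvg t0 lf).
    by rewrite mulr0; exact.
  - exact: iC.
  - apply: aeW => t n; rewrite /= in_itv/= andbT => t0; rewrite lee_fin ger0_norm//.
    exact: wC.
  by move=> _ _; rewrite integral0 => /fine_cvg.
apply: (@squeeze_cvgr _ _ _ _ (cst 0) (fun n => \int[leb]_(t in `[0, +oo[) w n t)) => //.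
- apply: nearW => n /=; rewrite L2nrm_ge0/=; exact: (resolvent_gap lam0 lf (gu n) lr hr (iw n)).
- exact: cvg_cst.
Qed.

End sequence.
End penalization_limit.

Theorem proposition3p7 (R : realType) (H : completeNormedModType R)
  (ip : {dot H for idfun}) (Hip : norm_from_ip ip)
  (Hsep : separable (H := H)) (Hdim : infinite_dimensional (H := H))
  (Q : {linear H -> H}) (HQ : covariance_operator ip Q)
  (mu : probability (borel H) R) (Hmu : gaussian_measure ip Q mu)
  (K : set H) (cK : closed K) (iK : interior K !=set0)
  (HKc : (0 < mu (~` K))%E)
  (d : measure_display) (Omega : measurableType d) (Pr : probability Omega R)
  (F : R -> set (set Omega)) (HF : filtration F)
  (W : R -> H -> Omega -> R) (HW : cylindrical_wiener Pr F W)
  (alpha : R) (Halpha : 0 <= alpha <= 1)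
  (X : R -> H -> Omega -> H)
  (HX : forall x, mild_solution ip Pr F W Q alpha x (fun t => X t x))
  (V : H -> R) (cV : continuous V) (bV : bounded_fun V)
  (V0 : forall x, K x -> V x = 0) (Vgt0 : forall x, (~` K) x -> 0 < V x)
  (P : R -> R -> (borel H -> R) -> borel H -> R)
  (HP : forall eps, 0 < eps -> penalized_semigroup Pr X mu V eps (P eps))
  (RM : R -> R -> (borel H -> R) -> borel H -> R)
  (HRM : forall eps lam, 0 < eps -> 0 < lam ->
    is_resolvent mu (P eps) lam (RM eps lam))
  (T : R -> (borel H -> R) -> borel H -> R)
  (HT : killed_semigroup Pr X mu cK T)
  (RL : R -> (borel H -> R) -> borel H -> R)
  (HRL : forall lam, 0 < lam -> is_laplace_resolvent (muK mu cK) T lam (RL lam))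
  (f : borel H -> R) (Hf : L2 (muK mu cK) f) :
  (forall t, 0 < t ->
    L2_lim0 (muK mu cK) (fun eps => P eps t (zero_ext K f)) (T t f)) /\
  (forall lam, 0 < lam ->
    L2_lim0 (muK mu cK) (fun eps => RM eps lam (zero_ext K f)) (RL lam f)).
Proof.
have mX x (t : R) (B : set (borel H)) : 0 <= t -> measurable B -> measurable (X t x @^-1` B).
  by move=> t0 mB; have [_ Fm _] := HF; apply: (Fm t t0); exact: (mild_adapted (HX x)).
have cX x := mild_continuous (HX x).
have lf' := L2_zero_ext Hf.
split=> [t t0|lam lam0].
  apply: L2_lim0_seq => [eps e0||eps e0 ec].
  - apply: L2_muK; apply: (semigroup_L2 (penalized_contraction (HP _ e0))) lf'.
    exact: ltW.
  - by apply: (semigroup_L2 (killed_contraction HT)) Hf; exact: ltW.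
  - exact: (penalized_cvg mX cX cV bV V0 Vgt0 HP HT e0 ec (ltW t0) Hf).
(* Being a right inverse of lam - M^eps, the resolvent satisfies the generator equation that the
   Laplace formula starts from. *)
have gRM eps : 0 < eps -> generator mu (P eps) (RM eps lam (zero_ext K f))
    (fun x => lam * RM eps lam (zero_ext K f) x - zero_ext K f x).
  by move=> e0; exact: (HRM _ _ e0 lam0).2.
have [lr hr] := (HRL _ lam0).2 _ Hf.
apply: L2_lim0_seq => [eps e0||eps e0 ec].
- by have [lu _ _] := gRM _ e0; exact: L2_muK.
- exact: lr.
- apply: (resolvent_cvg mX cX cV bV V0 Vgt0 HP HT e0 ec lam0 Hf _ lr hr).
  by move=> n; exact: gRM.
Qed.
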